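(* Let $V_1,V_2$ be Orlicz functions such that $V_1(x)/V_2(x)\to\infty$ as $|x|\to\infty$ and $\int_{\mathbb R}V_1(x)e^{\alpha V_2(x)}dx<\infty$ for all $\alpha\in(-\infty,0)$. For each $n$ let $X_1^{n,V_1}$ be uniformly distributed on $\mathbb B_1^{n,V_1}$. Then there exists $\overline R\in(0,\infty)$ such that for all $0<R\le\overline R$ and every fixed $k\in\mathbb N$, $$\lim_{\epsilon\to0}\lim_{n\to\infty}d_w\big(\lambda^{(n,k)}_{R,\epsilon},\,\lambda^{(n,k)}_{R,V_2}\big)=0,$$ where $\lambda^{(n,k)}_{R,\epsilon}:=P\big[(X_1^{n,V_1}(1),\dots,X_1^{n,V_1}(k))\in\cdot\,\big|\,X_1^{n,V_1}\in\mathbb B^{n,V_2}_{R+\epsilon}\big]$, $\lambda^{(n,k)}_{R,V_2}$ is the distribution of the first $k$ coordinates of a random vector uniformly distributed on $\mathbb B^{n,V_2}_R$, and $d_w$ is a metric inducing weak convergence of probability measures on $\mathbb R^k$.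
   Context: An Orlicz function is a convex, symmetric function $V:\mathbb R\to[0,\infty)$ with $V(0)=0$ and $V(x)>0$ for $x\neq0$. For $R>0$, $\mathbb B_R^{n,V}:=\{x\in\mathbb R^n:\sum_{k=1}^nV(x_k)\le Rn\}$. *)

(* Defs.v *)
From HB Require Import structures.
From mathcomp Require Import all_boot all_order all_algebra.
From mathcomp Require Import all_classical all_reals all_analysis.
Set Implicit Arguments. Unset Strict Implicit. Unset Printing Implicit Defensive.
Import Order.TTheory GRing.Theory Num.Theory.
Import numFieldNormedType.Exports.
Local Open Scope classical_set_scope.
Local Open Scope ring_scope.

Section Defs.
Variable R : realType.

(* Orlicz function: convex, symmetric, V 0 = 0, V x > 0 for x <> 0
   (nonnegativity of the codomain follows). *)
Definition orlicz (V : R -> R) : Prop :=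
  [/\ (forall x y t, 0 <= t <= 1 ->
          V (t * x + (1 - t) * y) <= t * V x + (1 - t) * V y),
      (forall x, V (- x) = V x),
      V 0 = 0 &
      (forall x, x != 0 -> 0 < V x)].

(* Points of R^n are represented as sequences s : seq R of length n. *)
(* Iterated Lebesgue integral over R^n (first coordinate outermost):
   iint n f = \int_{R} ... \int_{R} f(x_1,...,x_n) dx_n ... dx_1.
   For the (Borel, bounded) integrands used below this is the Lebesgue
   integral over R^n by Fubini/Tonelli. *)
Fixpoint iint (n : nat) (f : seq R -> \bar R) : \bar R :=
  match n with
  | 0 => f [::]
  | n'.+1 => (\int[@lebesgue_measure R]_(x in setT) iint n' (fun s => f (x :: s)))%E
  end.

Definition vol (n : nat) (A : set (seq R)) : \bar R :=
  iint n (fun s => (\1_A s)%:E).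

Definition orlicz_ball (V : R -> R) (n : nat) (Rad : R) : set (seq R) :=
  [set s | size s = n /\ \sum_(x <- s) V x <= Rad * n%:R].

Definition unif_E (n : nat) (A : set (seq R)) (h : seq R -> R) : R :=
  fine (iint n (fun s => (\1_A s * h s)%:E)) / fine (vol n A).

Definition proj_k (k : nat) (s : seq R) : 'rV[R]_k := \row_(i < k) nth 0 s i.

(* A probability law on R^k is represented by its expectation functional
   g |-> \int g d(law). *)
Definition law k := ('rV[R]_k -> R) -> R.

(* lambda^{(n,k)}_{R,eps}: law of the first k coordinates of X uniform on
   B_1^{n,V1}, conditioned on X in B_{R+eps}^{n,V2}:
   E[g(X_1..X_k) | X in B] = E[g(X_1..X_k) 1_B(X)] / P[X in B]. *)
Definition lam_cond (V1 V2 : R -> R) (n k : nat) (Rad eps : R) : law k :=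
  fun g =>
    unif_E n (orlicz_ball V1 n 1)
      (fun s => \1_(orlicz_ball V2 n (Rad + eps)) s * g (proj_k k s))
    / unif_E n (orlicz_ball V1 n 1) (fun s => \1_(orlicz_ball V2 n (Rad + eps)) s).

Definition lam_unif (V2 : R -> R) (n k : nat) (Rad : R) : law k :=
  fun g => unif_E n (orlicz_ball V2 n Rad) (fun s => g (proj_k k s)).

(* bounded-Lipschitz test functions on R^k (sup norm on R^k) *)
Definition BL1 (k : nat) : set ('rV[R]_k -> R) :=
  [set g | (forall x, `|g x| <= 1) /\ (forall x y, `|g x - g y| <= `|x - y|)].

(* Dudley's bounded-Lipschitz metric, which metrizes weak convergence of
   probability measures on R^k. *)
Definition d_BL (k : nat) (mu nu : law k) : R :=
  sup ((fun g => `|mu g - nu g|) @` @BL1 k).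

End Defs.

Arguments iint {R} n f.
Arguments vol {R} n A.
Arguments orlicz_ball {R} V n Rad.
Arguments unif_E {R} n A h.
Arguments proj_k {R} k s.
Arguments lam_cond {R} V1 V2 n k Rad eps.
Arguments lam_unif {R} V2 n k Rad.
Arguments BL1 {R} k.
Arguments d_BL {R} k mu nu.

(* Main.v *)
(* Write S_n(t) for the volume of {sum V2(x_i) <= t} in R^n.  An induction on n
   with a symmetric one-dimensional Prekopa-Leindler inequality shows that S_n
   is log-concave.  Exponential tilting by the Gibbs densities e^(-b V2)/Z(b)
   and Chernoff bounds give the growth rate of S_n(rn), so by concavity the
   slope of ln S_n near rn tends to the b for which V2 has Gibbs mean r.  The
   density of the first k coordinates of a uniform point of the V2-ball is
   S_(n-k)(rn - sum V2(x_i)) up to a constant; these slopes squeeze it between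
   Gibbs densities, which yields convergence to the Gibbs product law, uniformly
   over bounded Lipschitz test functions.  For r small, hence b large, V1 has
   Gibbs mean below 1, and the constraint sum V1(x_i) <= n is asymptotically
   satisfied on the V2-ball: V1 is truncated at M, the bounded part is handled by
   a Chernoff bound and the rest by Markov's inequality.  Hence conditioning has
   no effect in the limit, and only the continuity of r |-> b remains. *)
Require Import Defs.
From HB Require Import structures.
From mathcomp Require Import all_boot all_order all_algebra.
From mathcomp Require Import all_classical all_reals all_analysis.
From mathcomp Require Import measurable_realfun.
From mathcomp Require Import ring lra.
Set Implicit Arguments. Unset Strict Implicit. Unset Printing Implicit Defensive.
Import Order.TTheory GRing.Theory Num.Theory.
Import numFieldNormedType.Exports.
Local Open Scope classical_set_scope.
Local Open Scope ring_scope.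

(** The limit law of the coordinates depends on the ratios S_n(rn - u)/S_n(rn) for bounded u, which
    are of order one, whereas Chernoff bounds determine S_n only up to subexponential factors.
    Concavity of ln S_n closes this gap and replaces a local limit theorem: secants of length of
    order n have nearly the right slope, and they bound all secants beyond them. The one-dimensional
    inequality stays elementary because V2 is even and convex: the level sets involved are intervals
    centred at 0, whose measure is twice their radius. The faster growth of V1 may leave it without
    exponential moments under the Gibbs laws; hence the truncation, and the level 1/4 imposed on its
    Gibbs mean leaves half of the budget n to each of the two parts. The inner limit in n is
    identified exactly, as the distance between the Gibbs laws belonging to r + eps and r. *)

Section product_sigma_finite.
Context d d' (T : measurableType d) (T' : measurableType d') (R : realType).
Variables (m : {sigma_finite_measure set T -> \bar R})
          (m' : {sigma_finite_measure set T' -> \bar R}).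

Lemma sigma_finite_prod : sigma_finite setT (m \x m')%E.
Proof.
have [F FT mF] := sigma_finiteT m; have [G GT mG] := sigma_finiteT m'.
pose H (ij : nat * nat) := F ij.1 `*` G ij.2.
exists (fun n => if unpickle n is Some ij then H ij else set0).
  apply/seteqP; split=> // -[x y] _.
  have : [set: T] x by []. rewrite FT => -[i _ Fi].
  have : [set: T'] y by []. rewrite GT => -[j _ Gj].
  by exists (pickle (i, j)) => //; rewrite pickleK.
move=> n; case: unpickle => [[i j]|]; last by rewrite measure0.
have [mFi Fi] := mF i; have [mGj Gj] := mG j.
split; first exact: measurableX.
by rewrite product_measure1E// lte_mul_pinfty// ge0_fin_numE.
Qed.

(* The instance of the library is only found for products of
   (sub)probability measures. *)
Definition prod_sf : {sigma_finite_measure set (T * T')%type -> \bar R} :=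
  HB.pack_for (sigma_finite_measure (T * T')%type R) (m \x m')%E
    (Measure_isSigmaFinite.Build _ _ _ (m \x m')%E sigma_finite_prod).

End product_sigma_finite.

(** * Lebesgue measure on R^n as an iterated product, and integrals of functions of sequences *)

Section pspace.
Variable R : realType.
Notation leb := (@lebesgue_measure R).

(** The carrier of R^n, its display, its measure and the reading of a point as a sequence all depend
    on n, so the recursion has to produce them together. *)
Record mspace := MSpace {
  ms_disp : measure_display;
  ms_sort : measurableType ms_disp;
  ms_mu : {sigma_finite_measure set ms_sort -> \bar R};
  ms_seq : ms_sort -> seq R }.

Fixpoint pspace (n : nat) : mspace :=
  match n with
  | 0 => @MSpace _ unit (@dirac _ unit tt R) (fun=> [::])
  | n'.+1 => @MSpace _ (measurableTypeR R * ms_sort (pspace n'))%type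
               (prod_sf leb (ms_mu (pspace n')))
               (fun p => p.1 :: ms_seq p.2)
  end.

Notation mu n := (ms_mu (pspace n)).
Notation sq n := (@ms_seq (pspace n)).

Lemma size_sq n p : size (sq n p) = n.
Proof. by elim: n p => //= n ih p; rewrite ih. Qed.

Lemma measurable_sumV (V : R -> R) n : measurable_fun setT V ->
  measurable_fun setT (fun p => \sum_(x <- sq n p) V x).
Proof.
move=> mV; elim: n => [|n ih].
  by under eq_fun do rewrite big_nil; exact: measurable_cst.
under eq_fun do rewrite /= big_cons.
apply: measurable_funD; first exact: measurableT_comp.
exact: (measurableT_comp ih).
Qed.

Lemma measurable_nth_sq n i : measurable_fun setT (fun p => nth 0 (sq n p) i).
Proof.
elim: n i => [|n ih] i.
  by under eq_fun do rewrite nth_nil; exact: measurable_cst.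
case: i => [|i] /=.
  exact: measurable_fst.
exact: (measurableT_comp (ih i)).
Qed.

Definition meas n (f : seq R -> R) := measurable_fun setT (fun p => f (sq n p)).

Definition integr n (f : seq R -> R) :=
  (mu n).-integrable setT (EFin \o (fun p => f (sq n p))).

(** Unnormalised, hence not an expectation. It carries information only together with [integr],
    since [Rintegral] sends infinite values to 0. *)
Definition En n (f : seq R -> R) : R := \int[mu n]_p f (sq n p).

Lemma integr_meas n f : integr n f -> meas n f.
Proof. by move=> /measurable_int /measurable_EFinP. Qed.

Lemma EnE n f : integr n f -> (En n f)%:E = (\int[mu n]_p (f (sq n p))%:E)%E.
Proof. by move=> fi; rewrite /En /Rintegral fineK//; exact: integrable_fin_num. Qed.

Lemma meas_cons n f x : meas n.+1 f -> meas n (fun s => f (x :: s)).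
Proof.
move=> mf; have := measurableT_comp mf (measurable_pair1 _).
by apply.
Qed.

Lemma integral_mu_succ n f : meas n.+1 f -> (forall s, 0 <= f s) ->
  (\int[mu n.+1]_p (f (sq n.+1 p))%:E =
   \int[leb]_x \int[mu n]_q (f (x :: sq n q))%:E)%E.
Proof.
move=> mf f0; rewrite (fubini_tonelli1 (EFin \o (fun p => f (sq n.+1 p))))//.
- exact/measurable_EFinP.
- by move=> p; rewrite lee_fin.
Qed.

(** Integrability of every slice, not just of almost every one, makes the inner integral real for
    all x, so that Fubini can be stated between real integrals. *)
Lemma En_succ n f : integr n.+1 f -> (forall x, integr n (fun s => f (x :: s))) ->
  En n.+1 f = \int[leb]_x En n (fun s => f (x :: s)) /\
  leb.-integrable setT (fun x => (En n (fun s => f (x :: s)))%:E).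
Proof.
move=> fi fx.
have FE : (fun x => (En n (fun s => f (x :: s)))%:E) =
    fubini_F (mu n) (EFin \o (fun p => f (sq n.+1 p))).
  by apply/funext => x; rewrite EnE.
split; last by rewrite FE; exact: integrable_fubini_F.
rewrite /En /Rintegral; congr fine.
by rewrite -/(mu n.+1) -integral12_prod_meas1// -FE.
Qed.

Lemma integral_mu0 (g : seq R -> \bar R) : (\int[mu 0]_p g (sq 0 p))%E = g [::].
Proof.
have mg : measurable_fun [set: unit] (fun=> g [::]) by exact: measurable_cst.
have := @integral_dirac _ unit tt R setT measurableT _ mg.
by rewrite diracT mul1e.
Qed.

Lemma En0 f : integr 0 f /\ En 0 f = f [::].
Proof.
have mf : meas 0 f.
  rewrite (_ : meas 0 f = measurable_fun [set: unit] (cst (f [::])))//.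
split; last by rewrite /En /Rintegral (integral_mu0 (EFin \o f)).
apply/integrableP; split; first exact/measurable_EFinP.
by rewrite (integral_mu0 (fun s => `|(f s)%:E|%E)) ltry.
Qed.

Lemma meas_EFin n f : meas n f -> measurable_fun setT (fun p => (f (sq n p))%:E).
Proof. by move=> mf; exact/measurable_EFinP. Qed.

Lemma meas_exp_sum n (f : R -> R) : measurable_fun setT f ->
  meas n (fun s => expR (\sum_(x <- s) f x)).
Proof. by move=> mf; apply: measurableT_comp => //; exact: measurable_sumV. Qed.

Lemma integral_exp n (f : R -> R) : measurable_fun setT f ->
  leb.-integrable setT (EFin \o (expR \o f)) ->
  (\int[mu n]_p (expR (\sum_(x <- sq n p) f x))%:E =
   ((\int[leb]_x expR (f x)) ^+ n)%:E)%E.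
Proof.
move=> mf fi; set J := \int[leb]_x expR (f x).
have JE : (\int[leb]_x (expR (f x))%:E)%E = J%:E.
  by rewrite /J /Rintegral fineK//; exact: (integrable_fin_num _ fi).
elim: n => [|n ih].
  by rewrite (integral_mu0 (fun s => (expR (\sum_(x <- s) f x))%:E)) big_nil expR0.
rewrite (integral_mu_succ (f := fun s => expR (\sum_(x <- s) f x))); last 2 first.
  - exact: meas_exp_sum.
  - by move=> s; exact: expR_ge0.
transitivity (\int[leb]_x ((expR (f x))%:E * (J ^+ n)%:E))%E.
  apply: eq_integral.
  move=> x _; rewrite -ih.
  under eq_integral do rewrite big_cons expRD EFinM.
  rewrite ge0_integralZl_EFin ?expR_ge0//.
  exact: (meas_EFin (f := fun s => expR (\sum_(x <- s) f x)) (meas_exp_sum mf)).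
rewrite ge0_integralZr//.
- by rewrite JE -EFinM exprS.
- exact: (measurable_int _ fi).
- by rewrite lee_fin exprn_ge0// /J Rintegral_ge0// => x _; exact: expR_ge0.
Qed.

Lemma En_exp n (f : R -> R) : measurable_fun setT f ->
  leb.-integrable setT (EFin \o (expR \o f)) ->
  integr n (fun s => expR (\sum_(x <- s) f x)) /\
  En n (fun s => expR (\sum_(x <- s) f x)) = (\int[leb]_x expR (f x)) ^+ n.
Proof.
move=> mf fi; split; last by rewrite /En /Rintegral integral_exp.
apply/integrableP; split.
  exact: (meas_EFin (f := fun s => expR (\sum_(x <- s) f x)) (meas_exp_sum mf)).
under eq_integral do rewrite gee0_abs ?lee_fin ?expR_ge0//.
by rewrite integral_exp// ltry.
Qed.

Lemma le_integr n f g : meas n f -> (forall s, size s = n -> `|f s| <= g s) ->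
  integr n g -> integr n f.
Proof.
move=> mf fg; apply: le_integrable => //; first exact/measurable_EFinP.
move=> p _ /=; rewrite lee_fin (le_trans (fg _ (size_sq p)))//.
exact: ler_norm.
Qed.

Lemma En_le n f g : integr n f -> integr n g ->
  (forall s, size s = n -> f s <= g s) -> En n f <= En n g.
Proof. by move=> fi gi fg; apply: le_Rintegral => // p _; exact/fg/size_sq. Qed.

Lemma En_eq n f g : (forall s, size s = n -> f s = g s) -> En n f = En n g.
Proof. by move=> fg; apply: eq_Rintegral => p _; exact/fg/size_sq. Qed.

Lemma integr_eq n f g : (forall s, size s = n -> f s = g s) -> integr n f -> integr n g.
Proof. by move=> fg; apply: eq_integrable => // p _; rewrite /= fg// size_sq. Qed.

Lemma integrD n f g : integr n f -> integr n g -> integr n (fun s => f s + g s).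
Proof. by move=> fi gi; have := integrableD measurableT fi gi; apply: eq_integrable. Qed.

Lemma integrZ n c f : integr n f -> integr n (fun s => c * f s).
Proof. by move=> fi; have := integrableZl measurableT c fi; apply: eq_integrable. Qed.

Lemma EnD n f g : integr n f -> integr n g ->
  En n (fun s => f s + g s) = En n f + En n g.
Proof. by move=> fi gi; exact: RintegralD. Qed.

Lemma EnZ n c f : integr n f -> En n (fun s => c * f s) = c * En n f.
Proof. by move=> fi; exact: RintegralZl. Qed.

Lemma integrB n f g : integr n f -> integr n g -> integr n (fun s => f s - g s).
Proof. by move=> fi gi; have := integrableB measurableT fi gi; apply: eq_integrable. Qed.

Lemma EnB n f g : integr n f -> integr n g ->
  En n (fun s => f s - g s) = En n f - En n g.
Proof. by move=> fi gi; exact: RintegralB. Qed.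

Lemma En_norm n f : integr n f -> `|En n f| <= En n (fun s => `|f s|).
Proof. by move=> fi; exact: le_normr_Rintegral. Qed.

Lemma integr_norm n f : integr n f -> integr n (fun s => `|f s|).
Proof. by move=> /integrable_norm; apply: eq_integrable. Qed.

Lemma En_ge0 n f : (forall s, 0 <= f s) -> 0 <= En n f.
Proof. by move=> f0; apply: Rintegral_ge0. Qed.
End pspace.
Local Notation mu n := (ms_mu (pspace _ n)).
Local Notation sq n := (@ms_seq _ (pspace _ n)).

(** * Volumes of the sublevel sets of sum V(x_i) *)

Section sublevel.
Variable R : realType.
Notation leb := (@lebesgue_measure R).

(** Neither a length nor a factor n is built in, unlike in [orlicz_ball]: removing a coordinate then
    only shifts the level. *)
Definition sublevel (V : R -> R) (t : R) : set (seq R) :=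
  [set s | \sum_(x <- s) V x <= t].

Definition svol (V : R -> R) n t := En n (\1_(sublevel V t)).

Variable V : R -> R.
Hypothesis mV : measurable_fun setT V.
Hypothesis V0 : forall x, 0 <= V x.
Hypothesis iV : leb.-integrable setT (EFin \o (expR \o (fun x => - V x))).

Lemma sublevelE t s : \1_(sublevel V t) s = (\sum_(x <- s) V x <= t)%R%:R :> R.
Proof.
rewrite indicE; congr (_%:R); congr nat_of_bool.
by apply/idP/idP => [|h]; rewrite ?inE //; exact: mem_set.
Qed.

Lemma sublevel_cons t x s :
  \1_(sublevel V t) (x :: s) = \1_(sublevel V (t - V x)) s :> R.
Proof. by rewrite !sublevelE big_cons lerBrDl. Qed.

Lemma sublevel_ge0 t s : 0 <= \1_(sublevel V t) s :> R.
Proof. by rewrite sublevelE. Qed.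

Lemma meas_sublevel n t : meas n (\1_(sublevel V t) : _ -> R).
Proof.
have mA : measurable [set p : ms_sort (pspace R n) | \sum_(x <- sq n p) V x <= t].
  have -> : [set p : ms_sort (pspace R n) | \sum_(x <- sq n p) V x <= t] =
      setT `&` (fun p => \sum_(x <- sq n p) V x) @^-1` `]-oo, t].
    by rewrite setTI; apply/seteqP; split => p; rewrite /= in_itv.
  exact: (measurable_sumV mV) measurableT _ (measurable_itv _).
rewrite /meas.
have -> : (fun p => \1_(sublevel V t) (sq n p)) =
    \1_[set p : ms_sort (pspace R n) | \sum_(x <- sq n p) V x <= t] :> (_ -> R).
  by apply/funext => p; rewrite !indicE.
exact/measurable_indicP.
Qed.

(** This domination by an integrable product makes all volumes finite. *)
Lemma sublevel_le_exp t s : \1_(sublevel V t) s <= expR t * expR (\sum_(x <- s) - V x).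
Proof.
rewrite sublevelE -expRD sumrN; case: (leP _ t) => /= h; last by rewrite expR_ge0.
by rewrite -expR0 ler_expR subr_ge0.
Qed.

Let exp_V n := @En_exp R n _ (measurable_funN mV) iV.

Lemma bounded_integr n f c t : meas n f ->
  (forall s, `|f s| <= c * \1_(sublevel V t) s) -> integr n f.
Proof.
move=> mf fc; apply: (le_integr (g := fun s =>
    (`|c| * expR t) * expR (\sum_(x <- s) - V x))) => //.
  move=> s _; rewrite (le_trans (fc s))// -mulrA.
  rewrite (le_trans (ler_wpM2r (sublevel_ge0 _ _) (ler_norm c)))//.
  by rewrite ler_wpM2l// sublevel_le_exp.
exact/integrZ/(exp_V n).1.
Qed.

Lemma integr_sublevel n t : integr n (\1_(sublevel V t)).
Proof.
apply: (@bounded_integr _ _ 1 t); first exact: meas_sublevel.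
by move=> s; rewrite mul1r ger0_norm// sublevel_ge0.
Qed.

(** Bridge from the iterated integral of the statement to the measure on [pspace]. The domination by
    a sublevel indicator passes to slices with level t - V x, which is what the induction needs. *)
Lemma iint_En n f c t : meas n f ->
  (forall s, `|f s| <= c * \1_(sublevel V t) s) ->
  iint n (EFin \o f) = (En n f)%:E.
Proof.
elim: n f t => [|n ih] f t mf fc; first by rewrite (En0 f).2.
have fx x : integr n (fun s => f (x :: s)).
  apply: (@bounded_integr _ _ c (t - V x)); first exact: meas_cons.
  by move=> s; rewrite -sublevel_cons.
have [-> fi] := En_succ (bounded_integr mf fc) fx.
rewrite /Rintegral fineK//=; last exact: (integrable_fin_num _ fi).
apply: eq_integral => x _; apply: (ih _ (t - V x)); first exact: meas_cons.
by move=> s; rewrite -sublevel_cons.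
Qed.

Lemma svol_ge0 n t : 0 <= svol V n t.
Proof. by apply: En_ge0 => s; exact: sublevel_ge0. Qed.

Lemma le_svol n s t : s <= t -> svol V n s <= svol V n t.
Proof.
move=> st; apply: En_le; try exact: integr_sublevel.
move=> u _; rewrite !sublevelE ler_nat.
by case: leP => // us; rewrite (le_trans us st).
Qed.

Lemma svol_neg n t : t < 0 -> svol V n t = 0.
Proof.
move=> t0; rewrite /svol /En.
have -> : (fun p => \1_(sublevel V t) (sq n p)) = cst 0 :> (_ -> R).
  apply/funext => p; rewrite sublevelE leNgt (lt_le_trans t0)// sumr_ge0//.
by rewrite /Rintegral integral0.
Qed.

Lemma svol0 t : svol V 0 t = (0 <= t)%R%:R.
Proof. by rewrite /svol (En0 _).2 sublevelE big_nil. Qed.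

Lemma svol_succ n t : svol V n.+1 t = \int[leb]_x svol V n (t - V x) /\
  leb.-integrable setT (fun x => (svol V n (t - V x))%:E).
Proof.
have E x : En n (fun s => \1_(sublevel V t) (x :: s)) = svol V n (t - V x).
  by apply: En_eq => s _; rewrite sublevel_cons.
have := En_succ (integr_sublevel n.+1 t).
rewrite -/(svol _ _ _).
under [X in _ = X]eq_Rintegral do rewrite E.
under [X in integrable _ _ X]eq_fun do rewrite E.
apply => x; apply: (integr_eq _ (integr_sublevel n (t - V x))) => s _.
by rewrite sublevel_cons.
Qed.

Lemma measurable_svol n : measurable_fun setT (svol V n).
Proof. by apply: nondecreasing_measurable => // s t; exact: le_svol. Qed.

End sublevel.

Section iint_lemmas.
Variable R : realType.

Lemma iint_ext n (f g : seq R -> \bar R) :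
  (forall s, size s = n -> f s = g s) -> iint n f = iint n g.
Proof.
elim: n f g => [|n ih] f g fg /=; first exact: fg.
by apply: eq_integral => x _; apply: ih => s ns; apply: fg; rewrite /= ns.
Qed.

Lemma iint_cat k m (f : seq R -> \bar R) :
  iint (k + m) f = iint k (fun s => iint m (fun s' => f (s ++ s'))).
Proof.
elim: k f => [|k ih] f //=.
by apply: eq_integral => x _; rewrite ih.
Qed.
End iint_lemmas.

(** * Elementary properties of Orlicz functions *)

Section orlicz_facts.
Variable R : realType.
Notation leb := (@lebesgue_measure R).
Variable V : R -> R.
Hypothesis oV : orlicz V.

Lemma orlicz_ge0 x : 0 <= V x.
Proof.
case: oV => _ _ V00 Vp.
by have [->|/Vp/ltW//] := eqVneq x 0; rewrite V00.
Qed.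

Lemma orlicz_abs x : V `|x| = V x.
Proof. by case: oV => _ Vs _ _; case: (ler0P x). Qed.

Lemma orlicz_star t x : 0 <= t <= 1 -> V (t * x) <= t * V x.
Proof.
case: oV => cv _ V00 _ t01; have := cv x 0 t t01.
by rewrite mulr0 addr0 V00 mulr0 addr0.
Qed.

(** By symmetry both points may be taken nonnegative, and then |x| is a convex combination of |y|
    and 0, where V vanishes. *)
Lemma orlicz_mono x y : `|x| <= `|y| -> V x <= V y.
Proof.
move=> xy; rewrite -(orlicz_abs x) -(orlicz_abs y).
have [y0|y0] := eqVneq `|y| 0.
  by rewrite y0 in xy *; rewrite (_ : `|x| = 0)//; apply/eqP; rewrite eq_le xy normr_ge0.
have yp : 0 < `|y| by rewrite lt_def y0 normr_ge0.
have t01 : 0 <= `|x| / `|y| <= 1.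
  by rewrite divr_ge0//= ler_pdivrMr// mul1r.
rewrite -[in leLHS](divfK y0 `|x|) (le_trans (orlicz_star _ t01))//.
by rewrite ler_piMl ?orlicz_ge0//; case/andP: t01.
Qed.

Lemma orlicz_growth x : 1 <= `|x| -> `|x| * V 1 <= V x.
Proof.
move=> x1; have xp : 0 < `|x| by rewrite (lt_le_trans _ x1).
have t01 : 0 <= `|x|^-1 <= 1 by rewrite invr_ge0 normr_ge0/= invf_le1.
have := orlicz_star `|x| t01.
by rewrite mulVf ?gt_eqF// orlicz_abs mulrC ler_pdivlMr// mulrC.
Qed.

Lemma orlicz1_gt0 : 0 < V 1.
Proof. by case: oV => _ _ _; apply; rewrite oner_eq0. Qed.

Lemma orlicz_bounded x t : V x <= t -> `|x| <= 1 + `|t| / V 1.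
Proof.
move=> Vt; have [x1|/ltW x1] := leP 1 `|x|; last first.
  by rewrite (le_trans x1)// lerDl divr_ge0// orlicz_ge0.
have h : `|x| <= `|t| / V 1.
  rewrite ler_pdivlMr ?orlicz1_gt0// (le_trans (orlicz_growth x1))//.
  by rewrite (le_trans Vt)// ler_norm.
by rewrite (le_trans h)// lerDr.
Qed.

Lemma orlicz_measurable : measurable_fun setT V.
Proof.
(* Flattening V on the negative axis gives a function monotone on the whole line; V is recovered by
   composing with the absolute value. *)
have mW : measurable_fun setT (fun x : R => V (Num.max x 0)).
  apply: nondecreasing_measurable => // x y xy; apply: orlicz_mono.
  have m0 (z : R) : 0 <= Num.max z 0 by rewrite le_max lexx orbT.
  by rewrite !ger0_norm// ge_max !le_max xy lexx orbT.
have -> : V = (fun x : R => V (Num.max x 0)) \o (@Num.norm R R).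
  by apply/funext => x /=; rewrite max_l// orlicz_abs.
by apply: measurableT_comp => //; exact: normr_measurable.
Qed.

Lemma orlicz_small e : 0 < e -> exists2 a, 0 < a <= 1 & forall x, `|x| <= a -> V x <= e.
Proof.
move=> e0; exists (Num.min 1 (e / V 1)).
  by rewrite lt_min ltr01 divr_gt0 ?orlicz1_gt0//= ge_min lexx.
move=> x; rewrite le_min => /andP[x1 xe].
rewrite -orlicz_abs -[`|x|]mulr1 (le_trans (orlicz_star _ _))//.
  by rewrite normr_ge0.
by rewrite -ler_pdivlMr ?orlicz1_gt0.
Qed.
End orlicz_facts.

(** * One-dimensional Brunn-Minkowski for symmetric intervals, and the layer-cake formula *)

Section symmetric_brunn_minkowski.
Variable R : realType.
Notation leb := (@lebesgue_measure R).

(** These are the intervals centred at 0, with or without endpoints, including the empty set and the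
    line. *)
Definition balanced (A : set R) := forall x y, `|x| <= `|y| -> A y -> A x.

Lemma leb_sym_itv (u : R) : 0 <= u -> leb `[- u, u]%classic = (2 * u)%:E.
Proof.
move=> u0; rewrite lebesgue_measure_itv/= lte_fin.
case: ltP => [_|]; first by rewrite -EFinB opprK mulr2n mulrDl mul1r.
by move=> h; congr (_%:E); lra.
Qed.

Lemma balanced_ge (A : set R) (x : R) : measurable A -> balanced A -> 0 <= x -> A x ->
  ((2 * x)%:E <= leb A)%E.
Proof.
move=> mA bA x0 Ax; rewrite -leb_sym_itv//; apply: le_measure; rewrite ?inE//.
move=> y /=; rewrite in_itv/= -ler_norml => yx.
by apply: (bA _ x) => //; rewrite (ger0_norm x0).
Qed.

Lemma balanced_near (A : set R) (e : R) : measurable A -> balanced A -> A 0 -> (leb A < +oo)%E ->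
  0 < e -> exists2 x, 0 <= x /\ A x & fine (leb A) <= 2 * (x + e).
Proof.
move=> mA bA A0 Af e0; set m := fine (leb A).
have mE : leb A = m%:E by rewrite /m fineK// ge0_fin_numE.
(* The case of small measure is split off so that the radius m / 2 - e used below is nonnegative. If
   no point of A lay beyond that radius, A would have measure at most m - 2 * e. *)
have [h|h] := leP m (2 * e).
  by exists 0 => //; rewrite add0r.
apply: contrapT => ne.
have sub : A `<=` `[(- (m / 2 - e))%R, (m / 2 - e)%R]%classic.
  move=> y Ay /=; rewrite in_itv/= -ler_norml leNgt; apply/negP => hy.
  apply: ne; exists `|y|.
    by split => //; apply: (bA _ y) => //; rewrite normr_id.
  by lra.
have : (leb A <= leb `[(- (m / 2 - e))%R, (m / 2 - e)%R]%classic)%E.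
  by apply: le_measure; rewrite ?inE.
by rewrite leb_sym_itv ?mE ?lee_fin; lra.
Qed.

(** The measure of such a set is twice its radius, so it suffices to combine near-extremal
    nonnegative points of A and B; the tolerance e covers radii that are not attained. *)
Lemma balanced_bm (A B H : set R) (l : R) : measurable A -> measurable B -> measurable H ->
  balanced A -> balanced B -> balanced H -> A 0 -> B 0 ->
  (leb A < +oo)%E -> (leb B < +oo)%E -> 0 <= l <= 1 ->
  (forall x y, 0 <= x -> 0 <= y -> A x -> B y -> H (l * x + (1 - l) * y)) ->
  (l%:E * leb A + (1 - l)%:E * leb B <= leb H)%E.
Proof.
move=> mA mB mH bA bB bH A0 B0 Af Bf /andP[l0 l1] ABH.
have [Hf|] := ltP (leb H) +oo%E; last by rewrite leye_eq => /eqP ->; rewrite leey.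
have fE (X : set R) : (leb X < +oo)%E -> leb X = (fine (leb X))%:E.
  by move=> Xf; rewrite fineK// ge0_fin_numE.
rewrite (fE A)// (fE B)// (fE H)// -!EFinM -EFinD lee_fin.
apply/ler_addgt0Pr => e e0.
have e20 : 0 < e / 2 by rewrite divr_gt0.
have [x [x0 Ax] hx] := balanced_near mA bA A0 Af e20.
have [y [y0 By] hy] := balanced_near mB bB B0 Bf e20.
have l1' : 0 <= 1 - l by rewrite subr_ge0.
have z0 : 0 <= l * x + (1 - l) * y by rewrite addr_ge0// mulr_ge0.
have := balanced_ge mH bH z0 (ABH _ _ x0 y0 Ax By).
rewrite (fE H)// lee_fin => hz.
have : l * fine (leb A) <= l * (2 * (x + e / 2)) by rewrite ler_wpM2l.
have : (1 - l) * fine (leb B) <= (1 - l) * (2 * (y + e / 2)) by rewrite ler_wpM2l.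
nra.
Qed.

Lemma indic_iff (T T' : Type) (A : set T) (B : set T') x y :
  (A x <-> B y) -> \1_A x = \1_B y :> R.
Proof.
move=> AB; rewrite !indicE; congr (_%:R); congr nat_of_bool.
by apply/idP/idP; rewrite !inE => /AB.
Qed.

(** The value 0 for t <= 0 allows the layer-cake formula to be integrated over the whole line. *)
Definition layer (f : R -> R) (t : R) : \bar R :=
  if 0 < t then leb [set x | t <= f x] else 0%E.

Lemma layer_cake (f : R -> R) : measurable_fun setT f -> (forall x, 0 <= f x) ->
  measurable_fun setT (layer f) /\
  (\int[leb]_x (f x)%:E = \int[leb]_t layer f t)%E.
Proof.
move=> mf f0.
(* Indicator of the region under the graph, with the point first and the height second; the formula
   is Tonelli for it. *)
pose g (z : measurableTypeR R * measurableTypeR R) : R := \1_[set z | 0 < z.2 <= f z.1] z.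
have mg : measurable_fun setT (EFin \o g).
  apply/measurable_EFinP/measurable_indicP.
  have -> : [set z : measurableTypeR R * measurableTypeR R | 0 < z.2 <= f z.1] =
      setT `&` (fun z => (0 < z.2) && (z.2 <= f z.1)) @^-1` [set true].
    by rewrite setTI; apply/seteqP; split.
  have mb : measurable_fun setT (fun z : measurableTypeR R * measurableTypeR R =>
      (0 < z.2) && (z.2 <= f z.1)).
    apply: measurable_and.
      by apply: measurable_fun_ltr => //; exact: measurable_snd.
    apply: measurable_fun_ler; first exact: measurable_snd.
    exact: (measurableT_comp mf measurable_fst).
  exact: mb measurableT _ _.
have g0 z : (0 <= (EFin \o g) z)%E by rewrite lee_fin /g indicE.
have GE t : fubini_G leb (EFin \o g) t = layer f t.
  rewrite /fubini_G /layer; case: ifPn => t0.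
    transitivity (\int[leb]_x (\1_[set x | t <= f x] x)%:E)%E.
      apply: eq_integral => x _; congr EFin; apply: indic_iff => /=.
      by rewrite t0.
    rewrite integral_indic ?setIT//.
    have -> : [set x | t <= f x] = setT `&` f @^-1` `[t, +oo[%classic.
      by rewrite setTI; apply/seteqP; split => x; rewrite /= in_itv/= andbT.
    exact: mf measurableT _ (measurable_itv _).
  rewrite integral0_eq// => x _; rewrite /g /= indicE memNset//= (negbTE t0)//.
have FE x : fubini_F leb (EFin \o g) x = (f x)%:E.
  rewrite /fubini_F.
  transitivity (\int[leb]_t (\1_`]0, f x]%classic t)%:E)%E.
    by apply: eq_integral => t _; congr EFin; apply: indic_iff.
  rewrite integral_indic ?setIT//= lebesgue_measure_itv/= lte_fin.
  by case: ltP => [_|fx0]; rewrite ?sube0//; congr EFin; apply/le_anti; rewrite f0 fx0.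
have GE' : fubini_G leb (EFin \o g) = layer f by apply/funext => t; exact: GE.
split.
  by rewrite -GE'; exact: (measurable_fun_fubini_tonelli_G (m1 := leb) (EFin \o g) mg g0).
transitivity (\int[leb]_x fubini_F leb (EFin \o g) x)%E.
  by apply: eq_integral => x _; rewrite FE.
transitivity (\int[leb]_t fubini_G leb (EFin \o g) t)%E; last by rewrite GE'.
exact: (fubini_tonelli (m1 := leb) (m2 := leb) (EFin \o g) mg g0).
Qed.

End symmetric_brunn_minkowski.

(** * Log-concavity of the volumes in the level *)

Section log_concavity.
Variable R : realType.
Notation leb := (@lebesgue_measure R).

Lemma weighted_agm (l X Y : R) : 0 <= l <= 1 -> 0 < X -> 0 < Y ->
  expR (l * ln X + (1 - l) * ln Y) <= l * X + (1 - l) * Y.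
Proof.
move=> /andP[l0 l1] X0 Y0; set W := l * X + (1 - l) * Y.
have W0 : 0 < W.
  rewrite /W; have [->|l0'] := eqVneq l 0; first by rewrite mul0r add0r subr0 mul1r.
  by rewrite ltr_wpDr ?mulr_ge0 ?subr_ge0 ?(ltW Y0)// mulr_gt0// lt_def l0' l0.
(* Tangent line of [ln] at the arithmetic mean W; averaging it over X and Y cancels the linear
   terms. *)
have tangent (Z : R) : 0 < Z -> ln Z <= ln W + (Z / W - 1).
  move=> Z0; rewrite -lerBlDl -ln_div ?posrE//.
  have ZW : 0 < Z / W by rewrite divr_gt0.
  have := expR_ge1Dx (ln (Z / W)); rewrite lnK ?posrE//; lra.
rewrite -[leRHS](lnK (x := W)) ?posrE// ler_expR.
have := ler_wpM2l l0 (tangent _ X0).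
have l1' : 0 <= 1 - l by lra.
have := ler_wpM2l l1' (tangent _ Y0).
have : l * (X / W) + (1 - l) * (Y / W) = 1.
  by rewrite !mulrA -mulrDl divff// gt_eqF.
lra.
Qed.

Variable V : R -> R.
Hypothesis oV : orlicz V.
Hypothesis iV : leb.-integrable setT (EFin \o (expR \o (fun x => - V x))).
Let mV := orlicz_measurable oV.
Let V0 := orlicz_ge0 oV.

(** Both endpoint values must be positive, since [ln] takes a mere default value elsewhere. *)
Definition log_concave (S : R -> R) := forall a b l, 0 <= l <= 1 -> 0 < S a -> 0 < S b ->
  expR (l * ln (S a) + (1 - l) * ln (S b)) <= S (l * a + (1 - l) * b).

Section step.
Variable n : nat.
Let S := svol V n.
Let S_ge0 t : 0 <= S t. Proof. exact: svol_ge0. Qed.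
Let S_mono s t : s <= t -> S s <= S t. Proof. exact: (le_svol mV iV). Qed.

Let sec (a A : R) (x : R) := S (a - V x) / A.

Let sec_int a A : (\int[leb]_x (sec a A x)%:E = (svol V n.+1 a / A)%:E)%E.
Proof.
have [-> fi] := svol_succ mV iV n a.
under eq_integral do rewrite /sec mulrC EFinM.
rewrite integralZl// mulrC EFinM /Rintegral fineK//.
exact: (integrable_fin_num _ fi).
Qed.

Let sec_ge0 a A x : 0 < A -> 0 <= sec a A x.
Proof. by move=> A0; rewrite divr_ge0// ltW. Qed.

Let sec_meas a A : measurable_fun setT (sec a A).
Proof.
apply: measurable_funM => //; apply: (measurableT_comp (measurable_svol mV iV n)).
exact: measurable_funB.
Qed.

Let lev a A t := [set x | t <= sec a A x].

Let lev_meas a A t : measurable (lev a A t).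
Proof.
have -> : lev a A t = setT `&` sec a A @^-1` `[t, +oo[%classic.
  by rewrite setTI; apply/seteqP; split => x; rewrite /= in_itv/= andbT.
exact: sec_meas measurableT _ (measurable_itv _).
Qed.

Let lev_bal a A t : 0 < A -> balanced (lev a A t).
Proof.
move=> A0 x y xy h; apply: (le_trans h); rewrite /sec ler_pM2r ?invr_gt0//.
by apply: S_mono; rewrite lerB// orlicz_mono.
Qed.

Let lev_fin a A t : 0 < t -> 0 < A -> (leb (lev a A t) < +oo)%E.
Proof.
move=> t0 A0; pose K := 1 + `|a| / V 1.
have K0 : 0 <= K by rewrite addr_ge0// divr_ge0// V0.
apply: (@le_lt_trans _ _ (leb `[- K, K]%classic)); last by rewrite leb_sym_itv// ltry.
apply: le_measure; rewrite ?inE//; first exact: lev_meas.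
move=> x /= h; rewrite in_itv/= -ler_norml; apply: (orlicz_bounded oV).
rewrite leNgt; apply/negP => aV.
have : t <= S (a - V x) / A by [].
by rewrite /S (svol_neg V0) ?subr_lt0// mul0r leNgt t0.
Qed.

Let V00 : V 0 = 0. Proof. by case: oV. Qed.

(** Convexity of V with monotonicity and log-concavity of S send the l-combination of the superlevel
    sets for a and b into the one for c. Brunn-Minkowski at each height, integrated over heights,
    bounds the arithmetic mean of the normalised volumes; the weighted mean inequality makes it
    geometric, and the maxima A, B recombine into C. *)
Lemma log_concave_step : log_concave S -> log_concave (svol V n.+1).
Proof.
move=> lcS a b l l01 Sa Sb; have /andP[l0 l1] := l01.
have pos c : 0 < svol V n.+1 c -> 0 < S c.
  move=> h; rewrite lt_def S_ge0 andbT; apply/negP => /eqP Sc.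
  move: h; rewrite (svol_succ mV iV n c).1 /Rintegral integral0_eq ?ltxx// => x _.
  congr EFin; apply/le_anti; rewrite S_ge0 andbT -Sc S_mono//.
  by rewrite lerBlDr lerDl.
have A0 := pos _ Sa; have B0 := pos _ Sb.
set A := S a in A0; set B := S b in B0.
set C := expR (l * ln A + (1 - l) * ln B); have C0 : 0 < C by exact: expR_gt0.
set c := l * a + (1 - l) * b.
have key t : (l%:E * layer (sec a A) t + (1 - l)%:E * layer (sec b B) t <=
    layer (sec c C) t)%E.
  rewrite /layer; case: ifPn => [t0|]; last by rewrite !mule0 adde0.
  (* The sections for a and b have maximum 1 at 0: above height 1 both superlevel sets are empty,
     and up to height 1 both contain 0, as [balanced_bm] requires. *)
  have [t1|t1] := leP t 1; last first.
    have e (d D : R) : 0 < D -> D = S d -> [set x | t <= sec d D x] = set0.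
      move=> D0 DE; apply/seteqP; split => // x /= h.
      have : t <= 1.
        rewrite (le_trans h)// /sec ler_pdivrMr// mul1r DE S_mono//.
        by rewrite lerBlDr lerDl.
      by rewrite leNgt t1.
    by rewrite (e a)// (e b)// measure0 !mule0 adde0.
  have lev0 (d D : R) : 0 < D -> D <= S d -> lev d D t 0.
    by move=> D0 Dd; rewrite /lev/= /sec V00 subr0 (le_trans t1)// ler_pdivlMr// mul1r.
  apply: balanced_bm => //; try exact: lev_meas; try exact: lev_bal;
    try exact: lev_fin; try (by apply: lev0).
  move=> x y x0 y0 /=; rewrite /sec !ler_pdivlMr// => ta tb.
  have tA : 0 < t * A by rewrite mulr_gt0.
  have tB : 0 < t * B by rewrite mulr_gt0.
  apply: (@le_trans _ _ (S (l * (a - V x) + (1 - l) * (b - V y)))); last first.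
    apply: S_mono; case: oV => cv _ _ _; have := cv x y l l01.
    by rewrite /c; lra.
  apply: le_trans (lcS _ _ l l01 (lt_le_trans tA ta) (lt_le_trans tB tb)).
  have -> : t * C = expR (ln t + (l * ln A + (1 - l) * ln B)).
    by rewrite expRD lnK ?posrE.
  rewrite ler_expR.
  have la : ln t + ln A <= ln (S (a - V x)).
    by rewrite -lnM ?posrE// ler_ln ?posrE// (lt_le_trans tA).
  have lb : ln t + ln B <= ln (S (b - V y)).
    by rewrite -lnM ?posrE// ler_ln ?posrE// (lt_le_trans tB).
  have l1' : 0 <= 1 - l by rewrite subr_ge0.
  have := ler_wpM2l l0 la; have := ler_wpM2l l1' lb; lra.
have cake d D : 0 < D -> measurable_fun setT (layer (sec d D)) /\
    (\int[leb]_t layer (sec d D) t = (svol V n.+1 d / D)%:E)%E.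
  move=> D0; have [ml E] := layer_cake (sec_meas d D) (fun x => sec_ge0 d x D0).
  by split => //; rewrite -E sec_int.
have layer_ge0 d D t : (0 <= layer (sec d D) t)%E by rewrite /layer; case: ifP.
have [mA iA] := cake a A A0; have [mB iB] := cake b B B0; have [mC iC] := cake c C C0.
have pA := layer_ge0 a A; have pB := layer_ge0 b B.
set fA := layer (sec a A) in key mA iA pA; set fB := layer (sec b B) in key mB iB pB.
set fC := layer (sec c C) in key mC iC.
clearbody fA fB fC => {cake layer_ge0}.
have l1' : 0 <= 1 - l by rewrite subr_ge0.
have : (\int[leb]_t (l%:E * fA t + (1 - l)%:E * fB t) <=
    \int[leb]_t fC t)%E.
  apply: ge0_le_integral => //.
  - by move=> t _; rewrite adde_ge0// mule_ge0// lee_fin.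
  - by apply: emeasurable_funD; apply: measurable_funeM.
rewrite iC ge0_integralD//; first last.
- exact: measurable_funeM.
- by move=> t _; rewrite mule_ge0// lee_fin.
- exact: measurable_funeM.
- by move=> t _; rewrite mule_ge0// lee_fin.
rewrite !ge0_integralZl_EFin// iA iB -!EFinM -EFinD lee_fin ler_pdivlMr// => H.
apply: le_trans H.
set X := svol V n.+1 a / A; set Y := svol V n.+1 b / B.
have X0 : 0 < X by rewrite divr_gt0.
have Y0 : 0 < Y by rewrite divr_gt0.
have -> : svol V n.+1 a = X * A by rewrite divfK// gt_eqF.
have -> : svol V n.+1 b = Y * B by rewrite divfK// gt_eqF.
have -> : ln (X * A) = ln X + ln A by rewrite lnM ?posrE.
have -> : ln (Y * B) = ln Y + ln B by rewrite lnM ?posrE.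
rewrite (_ : l * (ln X + ln A) + (1 - l) * (ln Y + ln B) =
  (l * ln X + (1 - l) * ln Y) + (l * ln A + (1 - l) * ln B)); last by ring.
by rewrite expRD -/C ler_pM2r//; exact: weighted_agm.
Qed.
End step.

Lemma log_concave_svol n : log_concave (svol V n).
Proof.
elim: n => [|n ih]; last exact: log_concave_step.
move=> a b l /andP[l0 l1]; rewrite !svol0.
case: (leP 0 a) => a0; last by rewrite ltxx.
case: (leP 0 b) => b0; last by rewrite ltxx.
move=> _ _; rewrite ln1 !mulr0 addr0 expR0.
by rewrite addr_ge0// mulr_ge0// subr_ge0.
Qed.
End log_concavity.

(** * Comparison of secant slopes of a log-concave function *)

Section log_concave_slopes.
Variable R : realType.
Variable S : R -> R.
Hypothesis lcS : log_concave S.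
Hypothesis S_mono : forall s t, s <= t -> S s <= S t.
Hypothesis S_ge0 : forall s, 0 <= S s.

(** Concavity of [ln S] cleared of denominators, so that its consequences are linear arithmetic. *)
Lemma ln_three_points x y z : x <= y -> y <= z -> x < z -> 0 < S x ->
  (z - y) * ln (S x) + (y - x) * ln (S z) <= (z - x) * ln (S y).
Proof.
move=> xy yz xz Sx.
have Sy : 0 < S y by rewrite (lt_le_trans Sx)// S_mono.
have Sz : 0 < S z by rewrite (lt_le_trans Sy)// S_mono.
have zx : 0 < z - x by rewrite subr_gt0.
set l := (z - y) / (z - x).
have l01 : 0 <= l <= 1.
  by rewrite divr_ge0 ?subr_ge0 ?(ltW xz)//= ler_pdivrMr// mul1r lerD2l lerN2.
have l1 : 1 - l = (y - x) / (z - x).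
  by rewrite /l; field; rewrite gt_eqF.
have := lcS l01 Sx Sz.
rewrite (_ : l * x + (1 - l) * z = y); last by rewrite /l; field; rewrite gt_eqF.
rewrite -[leRHS](lnK (x := S y)) ?posrE// ler_expR l1 /l => h.
have := ler_wpM2l (ltW zx) h.
suff -> : (z - x) * ((z - y) / (z - x) * ln (S x) + (y - x) / (z - x) * ln (S z)) =
  (z - y) * ln (S x) + (y - x) * ln (S z) by [].
by field; rewrite gt_eqF.
Qed.

(** Secants of a concave function are steeper further left: the slope bound k passes from [q, p] to
    [t, p] and then to [s, t]. Where S s = 0 the logarithm says nothing, but the claim is
    trivial. *)
Lemma slope_left k s t q p : s <= t -> t <= q -> q < p -> 0 < S q ->
  S q * expR (k * (p - q)) <= S p -> S s <= S t * expR (- (k * (t - s))).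
Proof.
move=> st tq qp Sq h.
have [Ss|Ss] := ltP 0 (S s); last by rewrite (le_trans Ss)// mulr_ge0// expR_ge0.
have St : 0 < S t by rewrite (lt_le_trans Ss)// S_mono.
have Sp : 0 < S p by rewrite (lt_le_trans Sq)// S_mono// ltW.
have tp : t < p by rewrite (le_lt_trans tq).
have sp : s < p by rewrite (le_lt_trans st).
have A := ln_three_points tq (ltW qp) tp St.
have B := ln_three_points st (ltW tp) sp Ss.
have K : k * (p - q) <= ln (S p) - ln (S q).
  rewrite lerBrDl -[k * _]expRK -lnM ?posrE ?expR_gt0//.
  by rewrite ler_ln ?posrE// mulr_gt0// expR_gt0.
have C : k * (p - t) <= ln (S p) - ln (S t).
  have pq0 : 0 < p - q by rewrite subr_gt0.
  rewrite -(ler_pM2l pq0); have := ler_wpM2l (ltW (lt_le_trans pq0 (lerB (lexx p) tq))) K.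
  lra.
suff : k * (t - s) <= ln (S t) - ln (S s).
  move=> H; rewrite -(lnK (x := S t)) ?posrE// -[leLHS](lnK (x := S s)) ?posrE//.
  by rewrite -expRD ler_expR; lra.
have pt0 : 0 < p - t by rewrite subr_gt0.
rewrite -(ler_pM2l pt0); have ts0 : 0 <= t - s by rewrite subr_ge0.
have := ler_wpM2l ts0 C; lra.
Qed.

(** Mirror image: the upper bound on the slope passes from [q, p] to [q, s] and then to [s, t];
    monotonicity keeps all values positive. *)
Lemma slope_right k q p s t : q < p -> p <= s -> s <= t -> 0 < S q ->
  S p <= S q * expR (k * (p - q)) -> S t <= S s * expR (k * (t - s)).
Proof.
move=> qp ps st Sq h.
have Sp : 0 < S p by rewrite (lt_le_trans Sq)// S_mono// ltW.
have Ss : 0 < S s by rewrite (lt_le_trans Sp)// S_mono.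
have St : 0 < S t by rewrite (lt_le_trans Ss)// S_mono.
have qs : q < s by rewrite (lt_le_trans qp).
have qt : q < t by rewrite (lt_le_trans qs).
have A := ln_three_points (ltW qp) ps qs Sq.
have B := ln_three_points (ltW qs) st qt Sq.
have K : ln (S p) - ln (S q) <= k * (p - q).
  rewrite lerBlDl -[k * _]expRK -lnM ?posrE ?expR_gt0//.
  by rewrite ler_ln ?posrE// mulr_gt0// expR_gt0.
have pq0 : 0 < p - q by rewrite subr_gt0.
have sq0 : 0 < s - q by rewrite subr_gt0.
have C : ln (S s) - ln (S q) <= k * (s - q).
  by rewrite -(ler_pM2l pq0); have := ler_wpM2l (ltW sq0) K; lra.
suff : ln (S t) - ln (S s) <= k * (t - s).
  move=> H; rewrite -(lnK (x := S s)) ?posrE// -[leLHS](lnK (x := S t)) ?posrE//.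
  by rewrite -expRD ler_expR; lra.
rewrite -(ler_pM2l sq0); have ts0 : 0 <= t - s by rewrite subr_ge0.
have := ler_wpM2l ts0 C; lra.
Qed.
End log_concave_slopes.

(** * Real-valued Lebesgue integrals on the line *)

Section lebesgue_integral_real.
Variable R : realType.
Notation leb := (@lebesgue_measure R).
Implicit Types f g : R -> R.

Definition lint f := leb.-integrable setT (EFin \o f).

Lemma lint_le f g : measurable_fun setT f -> (forall x, `|f x| <= g x) ->
  lint g -> lint f.
Proof.
move=> mf fg; apply: le_integrable => //; first exact/measurable_EFinP.
by move=> x _ /=; rewrite lee_fin (le_trans (fg x))// ler_norm.
Qed.

Lemma lintD f g : lint f -> lint g -> lint (fun x => f x + g x).
Proof. by move=> fi gi; have := integrableD measurableT fi gi; apply: eq_integrable. Qed.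

Lemma lintB f g : lint f -> lint g -> lint (fun x => f x - g x).
Proof. by move=> fi gi; have := integrableB measurableT fi gi; apply: eq_integrable. Qed.

Lemma lintZ c f : lint f -> lint (fun x => c * f x).
Proof. by move=> fi; have := integrableZl measurableT c fi; apply: eq_integrable. Qed.

Lemma LI_le f g : lint f -> lint g -> (forall x, f x <= g x) ->
  \int[leb]_x f x <= \int[leb]_x g x.
Proof. by move=> fi gi fg; apply: le_Rintegral. Qed.

Lemma LID f g : lint f -> lint g ->
  \int[leb]_x (f x + g x) = \int[leb]_x f x + \int[leb]_x g x.
Proof. by move=> fi gi; exact: RintegralD. Qed.

Lemma LIB f g : lint f -> lint g ->
  \int[leb]_x (f x - g x) = \int[leb]_x f x - \int[leb]_x g x.
Proof. by move=> fi gi; exact: RintegralB. Qed.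

Lemma LIZ c f : lint f -> \int[leb]_x (c * f x) = c * \int[leb]_x f x.
Proof. by move=> fi; exact: RintegralZl. Qed.

Lemma LI_ge0 f : (forall x, 0 <= f x) -> 0 <= \int[leb]_x f x.
Proof. by move=> f0; apply: Rintegral_ge0. Qed.

Lemma lint_indic_itv (a : R) : 0 <= a ->
  lint (\1_`[- a, a]%classic) /\ \int[leb]_x \1_`[- a, a]%classic x = 2 * a.
Proof.
move=> a0; split.
  have := @integrable_indic_itv R (- a) a true false; exact.
by rewrite /Rintegral integral_indic// setIT [X in fine X](leb_sym_itv a0).
Qed.

Lemma LI_gt0 f c a : 0 < a -> 0 < c -> lint f -> (forall x, 0 <= f x) ->
  (forall x, `|x| <= a -> c <= f x) -> 0 < \int[leb]_x f x.
Proof.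
move=> a0 c0 fi f0 fc.
have [ii iE] := lint_indic_itv (ltW a0).
apply: (@lt_le_trans _ _ (\int[leb]_x (c * \1_`[- a, a]%classic x))).
  by rewrite LIZ// iE !mulr_gt0.
apply: LI_le => //; first exact: lintZ.
move=> x; rewrite indicE; case: (boolP (_ \in _)) => /= [|_]; last by rewrite mulr0.
by rewrite inE /= in_itv/= -ler_norml mulr1 => /fc.
Qed.

End lebesgue_integral_real.

(** * Inequalities for the exponential *)

Section exponential_inequalities.
Variable R : realType.
Implicit Types x y : R.

Lemma expR_sub1_le x : expR x - 1 <= x * expR x.
Proof.
have := expR_ge1Dx (- x); have e0 := expR_gt0 x.
rewrite -(ler_pM2l e0) -expRD subrr expR0; lra.
Qed.

Lemma expR_taylor2 x : expR x <= 1 + x + x ^+ 2 * expR `|x|.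
Proof.
have h := expR_sub1_le x; have e1 := expR_ge1Dx x.
have [x0|x0] := leP 0 x.
  rewrite ger0_norm//; have := ler_wpM2l x0 h; lra.
have e2 : 1 <= expR `|x| by rewrite -expR0 ler_expR normr_ge0.
have x20 : 0 <= x ^+ 2 by exact: sqr_ge0.
have := ler_wpM2l x20 e2; rewrite mulr1.
have : (- x) * (1 - expR x) <= (- x) * (- x) by rewrite ler_wpM2l; lra.
lra.
Qed.

Lemma sqr_le_expR y : 0 <= y -> y ^+ 2 <= 4 * expR y.
Proof.
move=> y0; have h : y / 2 <= expR (y / 2) by have := expR_ge1Dx (y / 2); lra.
have -> : expR y = expR (y / 2) * expR (y / 2) by rewrite -expRD; congr expR; lra.
have y20 : 0 <= y / 2 by lra.
have := ler_pM y20 y20 h h; lra.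
Qed.

Lemma le_expR y : y <= expR y.
Proof. by have := expR_ge1Dx y; lra. Qed.
End exponential_inequalities.

(** * Exponential tilting in a direction of negative mean *)

Section tilting.
Variable R : realType.
Notation leb := (@lebesgue_measure R).
Variables (h f : R -> R) (t0 : R).
Hypotheses (mh : measurable_fun setT h) (mf : measurable_fun setT f).
Hypothesis t0_gt0 : 0 < t0.
Hypothesis it0 : lint (fun x => expR (h x + t0 * `|f x|)).

Let mexp (g : R -> R) : measurable_fun setT g -> measurable_fun setT (fun x => expR (g x)).
Proof. by move=> mg; exact: measurableT_comp. Qed.

Lemma lint_tilt t : `|t| <= t0 -> lint (fun x => expR (h x + t * f x)).
Proof.
move=> tt0; apply: lint_le it0.
  by apply: mexp; apply: measurable_funD => //; exact: measurable_funM.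
move=> x; rewrite ger0_norm ?expR_ge0// ler_expR lerD2l.
by rewrite (le_trans (ler_norm _))// normrM ler_wpM2r.
Qed.

Lemma lint_tilt_mul : lint (fun x => f x * expR (h x)).
Proof.
have := lintZ t0^-1 it0; apply: lint_le.
  by apply: measurable_funM => //; exact: mexp.
move=> x; rewrite normrM (ger0_norm (expR_ge0 _)) addrC expRD mulrA.
rewrite ler_wpM2r ?expR_ge0// ler_pdivlMl//; exact: le_expR.
Qed.

(* The derivative at [t = 0] of the left-hand side is the negative number
   [\int f e^h]; the Taylor remainder is controlled by [e^(h + t0 |f|)]. *)
Lemma tilt_decrease : \int[leb]_x (f x * expR (h x)) < 0 ->
  exists2 t, 0 < t <= t0 &
    \int[leb]_x expR (h x + t * f x) < \int[leb]_x expR (h x).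
Proof.
set D := \int[leb]_x (f x * expR (h x)) => D0.
set K := \int[leb]_x expR (h x + t0 * `|f x|).
have K0 : 0 <= K by apply: LI_ge0 => x; exact: expR_ge0.
(* From y^2 <= 4 e^y at y = t0 |f| / 2 one gets f^2 <= (16 / t0^2) e^y, and t <= t0 / 2 bounds the
   other factor e^(t |f|) by e^y as well. The summand 1 added to K makes the final inequality
   strict. *)
pose c := 16 / t0 ^+ 2 * (K + 1).
have c0 : 0 < c by rewrite mulr_gt0 ?divr_gt0 ?exprn_gt0//; lra.
pose t := Num.min (t0 / 2) (- D / c).
have tp : 0 < t by rewrite lt_min !divr_gt0//; lra.
have t2 : t <= t0 / 2 by rewrite ge_min lexx.
have tc : t * c <= - D by rewrite -ler_pdivlMr// ge_min lexx orbT.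
exists t; first by rewrite tp/=; lra.
have ih : lint (fun x => expR (h x)).
  by have := @lint_tilt 0; rewrite normr0; under eq_fun do rewrite mul0r addr0;
    apply; exact: ltW.
have itf := lint_tilt_mul.
have pw x : expR (h x + t * f x) <= (expR (h x) + t * (f x * expR (h x))) +
    t ^+ 2 * (16 / t0 ^+ 2) * expR (h x + t0 * `|f x|).
  have := expR_taylor2 (t * f x); rewrite normrM (gtr0_norm tp) expRD => tay.
  have := ler_wpM2l (expR_ge0 (h x)) tay.
  suff : (t * f x) ^+ 2 * expR (t * `|f x|) <=
      t ^+ 2 * (16 / t0 ^+ 2) * expR (t0 * `|f x|).
    by move/(ler_wpM2l (expR_ge0 (h x))); rewrite expRD; lra.
  have y0 : 0 <= t0 * `|f x| / 2 by rewrite divr_ge0// mulr_ge0// ltW.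
  have := sqr_le_expR y0; set y := t0 * `|f x| / 2 in y0 * => sq.
  have f2 : f x ^+ 2 = 4 / t0 ^+ 2 * y ^+ 2.
    by rewrite /y -(real_normK (num_real (f x))); field; rewrite gt_eqF.
  have -> : expR (t0 * `|f x|) = expR y * expR y.
    by rewrite -expRD /y; congr expR; field.
  have e1 : expR (t * `|f x|) <= expR y.
    by rewrite ler_expR /y mulrAC ler_wpM2r.
  have -> : (t * f x) ^+ 2 * expR (t * `|f x|) =
      t ^+ 2 * (4 / t0 ^+ 2) * (y ^+ 2 * expR (t * `|f x|)).
    by rewrite exprMn f2; ring.
  have a0 : 0 <= t ^+ 2 * (4 / t0 ^+ 2) by rewrite mulr_ge0 ?divr_ge0 ?sqr_ge0.
  have := ler_wpM2l a0 (ler_pM (sqr_ge0 y) (expR_ge0 _) sq e1); lra.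
have := LI_le (@lint_tilt t _) _ pw.
rewrite ger0_norm ?(ltW tp)//.
have t0' : t <= t0 by lra.
move=> /(_ t0') H; have {}H := H (lintD (lintD ih (lintZ t itf)) (lintZ _ it0)).
rewrite LID in H; [|exact: lintD ih (lintZ t itf)|exact: lintZ].
rewrite LID in H; [|by[]|exact: lintZ].
rewrite !LIZ// -/D -/K in H.
apply: (le_lt_trans H).
have ct : t ^+ 2 * (16 / t0 ^+ 2) * K + t ^+ 2 * (16 / t0 ^+ 2) <= - (t * D).
  have -> : t ^+ 2 * (16 / t0 ^+ 2) * K + t ^+ 2 * (16 / t0 ^+ 2) = t * (t * c).
    by rewrite /c; ring.
  by rewrite -mulrN ler_wpM2l// ltW.
have : 0 < t ^+ 2 * (16 / t0 ^+ 2) by rewrite mulr_gt0 ?divr_gt0 ?exprn_gt0.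
lra.
Qed.
End tilting.

(** * The partition function and the Gibbs mean as a function of b *)

Section partition_function.
Variable R : realType.
Notation leb := (@lebesgue_measure R).
Variable V : R -> R.
Hypothesis oV : orlicz V.
Hypothesis iV : forall b, 0 < b -> lint (fun x => expR (- b * V x)).
Let mV := orlicz_measurable oV.
Let V0 := orlicz_ge0 oV.

Definition Zf b := \int[leb]_x expR (- b * V x).
(** This is Z(b) times the Gibbs mean of V at b minus c: its sign compares the mean with c, and no
    division is involved. *)
Definition Dv b c := \int[leb]_x ((V x - c) * expR (- b * V x)).

Let mexpV b : measurable_fun setT (fun x => expR (- b * V x)).
Proof. by apply: measurableT_comp => //; exact: measurable_funM. Qed.

Lemma lint_exp1 : lint (fun x => expR (- V x)).
Proof. by have := iV ltr01; under eq_fun do rewrite mulN1r. Qed.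

(** Half of the exponent pays for the square, by y^2 <= 4 e^y at y = b V / 2. *)
Lemma lint_sqrV b : 0 < b -> lint (fun x => V x ^+ 2 * expR (- b * V x)).
Proof.
move=> b0; have b20 : 0 < b / 2 by rewrite divr_gt0.
have := lintZ (16 / b ^+ 2) (iV b20); apply: lint_le.
  by apply: measurable_funM => //; exact: measurable_funX.
move=> x; rewrite ger0_norm ?mulr_ge0 ?sqr_ge0 ?expR_ge0//.
have y0 : 0 <= b / 2 * V x by rewrite mulr_ge0// ltW.
have := sqr_le_expR y0 => h.
have -> : V x ^+ 2 = 4 / b ^+ 2 * (b / 2 * V x) ^+ 2 by field; rewrite gt_eqF.
have -> : expR (- b * V x) = expR (- (b / 2 * V x)) * expR (- (b / 2) * V x).
  by rewrite -expRD; congr expR; field.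
have -> : 16 / b ^+ 2 * expR (- (b / 2) * V x) = 4 / b ^+ 2 * ((4 * expR (b / 2 * V x)) *
    (expR (- (b / 2 * V x)) * expR (- (b / 2) * V x))).
  by rewrite !mulrA -[_ * expR (b / 2 * V x) * _]mulrA -expRD subrr expR0; field; rewrite gt_eqF.
rewrite -[leLHS]mulrA ler_wpM2l ?divr_ge0 ?sqr_ge0//.
by rewrite ler_wpM2r// mulr_ge0 ?expR_ge0.
Qed.

Lemma lint_V b : 0 < b -> lint (fun x => V x * expR (- b * V x)).
Proof.
move=> b0; have := lintD (iV b0) (lint_sqrV b0); apply: lint_le.
  exact: measurable_funM.
move=> x; rewrite ger0_norm ?mulr_ge0 ?expR_ge0// -[X in _ <= X + _]mul1r -mulrDl.
rewrite ler_wpM2r ?expR_ge0//; have := V0 x; have := sqr_ge0 (V x - 1); rewrite sqrrB1; lra.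
Qed.

Lemma lint_Dv b c : 0 < b -> lint (fun x => (V x - c) * expR (- b * V x)).
Proof.
move=> b0; have := lintB (lint_V b0) (lintZ c (iV b0)).
by under eq_fun do rewrite -mulrBl.
Qed.

Lemma Zf_gt0 b : 0 < b -> 0 < Zf b.
Proof.
move=> b0; have [a /andP[a0 _] Va] := orlicz_small oV (@ltr01 R).
apply: (LI_gt0 a0 (expR_gt0 (- b)) (iV b0)) => x; first exact: expR_ge0.
by move=> xa; rewrite ler_expR -[leLHS]mulr1 ler_nM2l ?oppr_lt0// Va.
Qed.

Lemma DvE b c : 0 < b -> Dv b c = \int[leb]_x (V x * expR (- b * V x)) - c * Zf b.
Proof.
move=> b0; rewrite /Dv /Zf -LIZ; last exact: iV.
rewrite -LIB; [|exact: lint_V|exact/lintZ/iV].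
by apply: eq_Rintegral => x _; rewrite mulrBl.
Qed.

Lemma Dv_shift b c e : 0 < b -> Dv b (c + e) = Dv b c - e * Zf b.
Proof. by move=> b0; rewrite !DvE//; ring. Qed.

(** The Gibbs mean decreases strictly in b. With h = b2 - b1, the factors V - c and e^(-hc) -
    e^(-hV) have the same sign, and their product is bounded below near 0, where V <= c / 2. So its
    integral against e^(-b1 V), which is e^(-hc) D(b1, c) - D(b2, c), is positive. *)
Lemma Dv_strict b1 b2 c : 0 < b1 -> b1 < b2 -> 0 < c -> Dv b1 c <= 0 -> Dv b2 c < 0.
Proof.
move=> b10 b12 c0 D1; have b20 : 0 < b2 by rewrite (lt_trans b10).
set h := b2 - b1; have h0 : 0 < h by rewrite subr_gt0.
pose g x := (V x - c) * (expR (- h * c) - expR (- h * V x)) * expR (- b1 * V x).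
have gE x : g x = expR (- h * c) * ((V x - c) * expR (- b1 * V x)) -
    (V x - c) * expR (- b2 * V x).
  rewrite /g (_ : expR (- b2 * V x) = expR (- h * V x) * expR (- b1 * V x)); first by ring.
  by rewrite -expRD; congr expR; rewrite /h; ring.
have i1 := lintZ (expR (- h * c)) (lint_Dv c b10).
have i2 := lint_Dv c b20.
have ig : lint g by have := lintB i1 i2; under eq_fun do rewrite -gE.
have g0 x : 0 <= g x.
  rewrite /g mulr_ge0 ?expR_ge0//; have [Vc|Vc] := leP c (V x).
    by rewrite mulr_ge0// subr_ge0// ler_expR ler_nM2l// oppr_lt0.
  rewrite -mulrNN mulr_ge0// oppr_ge0 subr_le0 ?ltW//.
  by rewrite ltr_expR ltr_nM2l// oppr_lt0.
have c20 : 0 < c / 2 by rewrite divr_gt0.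
have [a /andP[a0 _] Va] := orlicz_small oV c20.
have : 0 < \int[leb]_x g x.
  pose d := c / 2 * (expR (- h * (c / 2)) - expR (- h * c)) * expR (- b1 * (c / 2)).
  have d0 : 0 < d.
    rewrite /d mulr_gt0 ?expR_gt0// mulr_gt0// subr_gt0 ltr_expR ltr_nM2l ?oppr_lt0//; lra.
  apply: (LI_gt0 a0 d0 ig) => // x /Va Vx; rewrite /d /g.
  have -> : (V x - c) * (expR (- h * c) - expR (- h * V x)) =
      (c - V x) * (expR (- h * V x) - expR (- h * c)) by ring.
  have e1 : expR (- h * (c / 2)) <= expR (- h * V x) by rewrite ler_expR ler_nM2l// oppr_lt0.
  have e2 : expR (- h * c) <= expR (- h * (c / 2)).
    by rewrite ler_expR ler_nM2l ?oppr_lt0//; lra.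
  have e3 : expR (- b1 * (c / 2)) <= expR (- b1 * V x).
    by rewrite ler_expR ler_nM2l// oppr_lt0.
  have p1 : 0 <= expR (- h * (c / 2)) - expR (- h * c) by lra.
  have p2 : 0 <= c / 2 by lra.
  apply: ler_pM; [exact: mulr_ge0|exact: expR_ge0| |exact: e3].
  apply: ler_pM; [exact: p2|exact: p1|lra|lra].
under eq_Rintegral do rewrite gE.
rewrite LIB// LIZ; last exact: lint_Dv.
rewrite -/(Dv b1 c) -/(Dv b2 c).
have : expR (- h * c) * Dv b1 c <= 0 by rewrite mulr_ge0_le0// expR_ge0.
lra.
Qed.

(** The derivative in b of the integrand is at most (V + c) V e^(-b0 V) in absolute value for all b
    >= b0. *)
Lemma Dv_lipschitz b0 c : 0 < b0 -> 0 <= c -> exists2 K, 0 < K &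
  forall b b', b0 <= b -> b0 <= b' -> `|Dv b c - Dv b' c| <= K * `|b - b'|.
Proof.
move=> b00 c0; set f := fun x => (V x + c) * (V x * expR (- b0 * V x)).
have fi : lint f.
  have := lintD (lint_sqrV b00) (lintZ c (lint_V b00)).
  by congr lint; apply/funext => x; rewrite /f; ring.
have f0 x : 0 <= f x by rewrite /f !mulr_ge0 ?expR_ge0// addr_ge0.
exists (\int[leb]_x f x + 1); first by rewrite ltr_wpDl// LI_ge0.
suff main b b' : b0 <= b -> b <= b' -> `|Dv b c - Dv b' c| <= (\int[leb]_x f x + 1) * `|b - b'|.
  move=> b b' hb hb'; have [bb'|/ltW bb'] := leP b b'; first exact: main.
  by rewrite distrC [`|b - _|]distrC; exact: main.
move=> hb bb'; have bp : 0 < b by rewrite (lt_le_trans b00).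
have bp' : 0 < b' by rewrite (lt_le_trans bp).
rewrite /Dv -LIB; [|exact: lint_Dv|exact: lint_Dv].
have gi := lintB (lint_Dv c bp) (lint_Dv c bp').
apply: (le_trans (le_normr_Rintegral measurableT gi)).
rewrite mulrDl mul1r; apply: ler_wpDr => //.
rewrite mulrC -LIZ//; apply: LI_le => //; first 1 last.
  exact: lintZ.
  move=> x; rewrite -mulrBr normrM /f mulrCA ler_pM//.
    by rewrite (le_trans (ler_normB _ _))// !ger0_norm.
  have e1 : expR (- b' * V x) <= expR (- b * V x).
    by rewrite ler_expR ler_wpM2r// lerN2.
  rewrite ger0_norm ?subr_ge0// [`|b - b'|]distrC ger0_norm ?subr_ge0//.
  have -> : expR (- b' * V x) = expR (- b * V x) * expR (- (b' - b) * V x).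
    by rewrite -expRD; congr expR; ring.
  have := expR_ge1Dx (- (b' - b) * V x) => h1.
  have e2 : expR (- b * V x) <= expR (- b0 * V x) by rewrite ler_expR ler_wpM2r// lerN2.
  have h2 := ler_wpM2l (expR_ge0 (- b * V x)) h1.
  have h3 : 0 <= (b' - b) * V x by rewrite mulr_ge0// subr_ge0.
  have := ler_wpM2l h3 e2; lra.
have := integrable_norm gi; exact: eq_integrable.
Qed.

(** As b grows the Gibbs law concentrates at 0, where W vanishes. Off [-a, a] one has V >= v, so the
    weight there is at most e^(-(b-1)v) e^(-V), while Z(b) decays no faster than e^(-bv/2) because V
    <= v / 2 on [-a', a']. *)
Lemma concentration (W : R -> R) e : orlicz W ->
  (forall b, 0 < b -> lint (fun x => W x * expR (- b * V x))) -> 0 < e ->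
  exists2 b0, 1 <= b0 & forall b, b0 <= b ->
    \int[leb]_x (W x * expR (- b * V x)) <= e * Zf b.
Proof.
move=> oW iW e0; have e20 : 0 < e / 2 by rewrite divr_gt0.
have [a /andP[a0 _] Wa] := orlicz_small oW e20.
pose v := V a; have v0 : 0 < v by case: oV => _ _ _; apply; rewrite gt_eqF.
have v20 : 0 < v / 2 by rewrite divr_gt0.
have [a' /andP[a'0 _] Va'] := orlicz_small oV v20.
set K := \int[leb]_x (W x * expR (- 1 * V x)).
have K0 : 0 <= K by apply: LI_ge0 => x; rewrite mulr_ge0 ?expR_ge0// (orlicz_ge0 oW).
(* For b >= b0 this yields [2 * expR v * K <= v * e * a' * b], which y e^(-y) <= 1 at y = b v / 2
   turns into the bound on the tail. *)
pose b0 := 1 + 2 * expR v * K / (v * e * a').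
have q0 : 0 <= 2 * expR v * K / (v * e * a').
  by rewrite divr_ge0 ?mulr_ge0 ?expR_ge0 // ltW.
exists b0 => [|b b0b]; first by rewrite /b0 lerDl.
have b1 : 1 <= b by rewrite (le_trans _ b0b)// /b0 lerDl.
have bp : 0 < b by lra.
have [ii iE] := lint_indic_itv (ltW a'0).
have Zlow : 2 * a' * expR (- b * (v / 2)) <= Zf b.
  rewrite mulrC -iE -LIZ//; apply: LI_le; [exact: lintZ|exact: iV|].
  move=> x; rewrite indicE; case: (boolP (_ \in _)) => /= [|_]; last by rewrite mulr0 expR_ge0.
  rewrite inE/= in_itv/= -ler_norml mulr1 => /Va' Vx.
  by rewrite ler_expR ler_nM2l ?oppr_lt0.
have : \int[leb]_x (W x * expR (- b * V x)) <=
    e / 2 * Zf b + expR (- (b - 1) * v) * K.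
  have i1 := iW _ ltr01; have i2 := iW _ bp; have i3 := iV bp.
  rewrite /Zf /K -!LIZ// -LID; [|exact: lintZ|exact: lintZ].
  apply: LI_le; [exact: i2|apply: lintD; exact: lintZ|].
  move=> x; have [xa|xa] := leP `|x| a.
    rewrite ler_wpDr ?ler_wpM2r ?expR_ge0// ?Wa//.
    by rewrite !mulr_ge0 ?expR_ge0// (orlicz_ge0 oW).
  apply: ler_wpDl; first by rewrite mulr_ge0 ?expR_ge0 ?(ltW e20).
  rewrite mulrCA ler_wpM2l ?(orlicz_ge0 oW)// -expRD ler_expR.
  have : v <= V x by apply: orlicz_mono => //; rewrite gtr0_norm// ltW.
  have b10 : 0 <= b - 1 by lra.
  by move/(ler_wpM2l b10); lra.
move=> /le_trans; apply.
suff : expR (- (b - 1) * v) * K <= e / 2 * (2 * a' * expR (- b * (v / 2))).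
  by have := ler_wpM2l (ltW e20) Zlow; lra.
have -> : expR (- (b - 1) * v) = expR v * expR (- b * (v / 2)) * expR (- (b * (v / 2))).
  by rewrite -!expRD; congr expR; field.
have y0 : 0 < b * (v / 2) by rewrite mulr_gt0.
have small : expR (- (b * (v / 2))) * (b * (v / 2)) <= 1.
  by rewrite expRN mulrC ler_pdivrMr ?expR_gt0// mul1r le_expR.
have b0' : 2 * expR v * K <= (v * e * a') * b.
  rewrite [leRHS]mulrC -ler_pdivrMr ?mulr_gt0//; move: b0b; rewrite /b0; lra.
have E0 := expR_ge0 (- (b * (v / 2))).
have := ler_wpM2l E0 b0'.
have : e * a' * (expR (- (b * (v / 2))) * (b * (v / 2))) <= e * a'.
  by rewrite ler_piMr// mulr_ge0// ltW.
move=> h1 h2.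
have h3 : expR v * expR (- (b * (v / 2))) * K <= e * a' by lra.
by have := ler_wpM2l (expR_ge0 (- b * (v / 2))) h3; lra.
Qed.

Lemma exists_beta b0 c : 0 < b0 -> 0 < c -> 0 < Dv b0 c ->
  exists2 b, b0 < b & Dv b c = 0.
Proof.
move=> b00 c0 D0; have c20 : 0 < c / 2 by rewrite divr_gt0.
have [b1 b11 Hb1] := concentration oV (fun b h => lint_V h) c20.
pose b2 := Num.max b0 b1.
have b02 : b0 <= b2 by rewrite le_max lexx.
have b20 : 0 < b2 by rewrite (lt_le_trans b00).
have D2 : Dv b2 c < 0.
  rewrite DvE//; have := Hb1 b2; rewrite le_max lexx orbT => /(_ isT).
  have : 0 < c / 2 * Zf b2 by rewrite mulr_gt0// Zf_gt0.
  lra.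
have [K K0 lip] := Dv_lipschitz b00 (ltW c0).
(* The Lipschitz bound holds only to the right of b0; clamping makes F continuous on the whole line
   for the intermediate value theorem. *)
pose F b := Dv (Num.max b0 b) c.
have Fc : continuous F.
  move=> x; apply/cvgrPdist_le => e e0.
  near=> y; have M z : b0 <= Num.max b0 z by rewrite le_max lexx.
  rewrite (le_trans (lip _ _ (M x) (M y)))//.
  rewrite -ler_pdivlMl//.
  apply: (@le_trans _ _ `|x - y|); last first.
    near: y; apply: cvgr_dist_le; [exact: cvg_id|by rewrite mulr_gt0 ?invr_gt0].
  rewrite /Num.max; case: ltP => h1; case: ltP => h2 //.
  - by have := ler_norm (x - y) => ?; rewrite ger0_norm; lra.
  - have := ler_norm (y - x); rewrite [`|y - x|]distrC [`|b0 - y|]distrC => ?.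
    by rewrite ger0_norm; lra.
  - by rewrite subrr normr0.
have := @IVT R F b0 b2 0 b02 (continuous_subspaceT Fc).
have -> : F b0 = Dv b0 c by rewrite /F /Num.max ltxx.
have -> : F b2 = Dv b2 c by rewrite /F max_r.
rewrite /Num.min /Num.max; case: ltP => [|_]; first by move=> ?; lra.
rewrite (ltW D2) (ltW D0) => /(_ isT)[b]; rewrite in_itv/= => /andP[b0b _].
rewrite /F max_r// => Db.
exists b => //; rewrite lt_def b0b andbT; apply/eqP => bE.
by rewrite -bE Db ltxx in D0.

Unshelve. all: by end_near. Qed.

End partition_function.

(** * Estimates for large n *)

Section large_n.
Variable R : realType.
Implicit Types k C J Z e p q : R.

Lemma near_ge_mul k C : 0 < k -> \forall n \near \oo, C <= k * n%:R.
Proof.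
move=> k0; near=> n; rewrite -ler_pdivrMl//.
near: n; exact: nbhs_infty_ger.
Unshelve. all: by end_near. Qed.

Lemma near_geometric J Z e : 0 <= J -> J < Z -> 0 < e ->
  \forall n \near \oo, J ^+ n <= e * Z ^+ n.
Proof.
move=> J0 JZ e0; have Z0 : 0 < Z by rewrite (le_lt_trans J0).
have q1 : `|J / Z| < 1 by rewrite ger0_norm ?divr_ge0 ?(ltW Z0)// ltr_pdivrMr// mul1r.
have small : \forall n \near \oo, `|0 - (J / Z) ^+ n| <= e.
  by apply: cvgr_dist_le => //; exact: cvg_expr.
near=> n; rewrite -ler_pdivrMr ?exprn_gt0// -expr_div_n.
have : `|0 - (J / Z) ^+ n| <= e by near: n.
by rewrite sub0r normrN ger0_norm// exprn_ge0// divr_ge0// ltW.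
Unshelve. all: by end_near. Qed.

Lemma En_chernoff n (f : R -> R) (A : seq R -> R) (c : R) :
  measurable_fun setT f -> lint (fun x => expR (f x)) -> integr n A ->
  (forall s, size s = n -> A s <= expR c * expR (\sum_(x <- s) f x)) ->
  En n A <= expR c * (\int[@lebesgue_measure R]_x expR (f x)) ^+ n.
Proof.
move=> mf fi Ai Af; have [ei <-] := En_exp n mf fi.
by rewrite -EnZ//; apply: En_le => //; exact: integrZ.
Qed.

Lemma sum_affine (V : R -> R) p q s :
  \sum_(x <- s) (p * V x + q) = p * \sum_(x <- s) V x + q * (size s)%:R.
Proof.
rewrite big_split/= -mulr_sumr big_const_seq count_predT iter_addr_0.
by rewrite mulr_natr.
Qed.
End large_n.

(** * Growth rate of the volumes and slopes of their logarithm *)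

Section sublevel_asymptotics.
Variable R : realType.
Notation leb := (@lebesgue_measure R).
Variable V : R -> R.
Hypothesis oV : orlicz V.
Hypothesis iV : forall b, 0 < b -> lint (fun x => expR (- b * V x)).
Let mV := orlicz_measurable oV.
Let V0 := orlicz_ge0 oV.
Let iV1 := lint_exp1 iV.
Notation Z := (Zf V).
Notation D := (Dv V).

Lemma sublevel_chernoff b t s : 0 < b ->
  \1_(sublevel V t) s <= expR (b * t) * expR (\sum_(x <- s) - b * V x).
Proof.
move=> b0; rewrite sublevelE -expRD -mulr_sumr.
case: (leP _ t) => /= h; last by rewrite expR_ge0.
by rewrite -expR0 ler_expR mulNr subr_ge0 ler_pM2l.
Qed.

Lemma svol_upper b n t : 0 < b -> svol V n t <= expR (b * t) * Z b ^+ n.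
Proof.
move=> b0; apply: En_chernoff; [exact: measurable_funM|exact: iV| |].
  exact: integr_sublevel.
by move=> s _; exact: sublevel_chernoff.
Qed.

(** The two Chernoff tilts, one against sums above cn and one against sums below an. Keeping t <= b
    / 2 leaves enough of e^(-bV) for integrability. *)
Let tilted b a c : b / 2 > 0 -> D b c < 0 -> 0 < D b a ->
  [/\ exists2 t, 0 < t <= b / 2 & \int[leb]_x expR ((t - b) * V x + - t * c) < Z b &
   exists2 t, 0 < t <= b / 2 & \int[leb]_x expR ((- t - b) * V x + t * a) < Z b].
Proof.
move=> b20 Dc Da.
have itilt (d : R) (f : R -> R) : (forall x, `|f x| <= V x + `|d|) ->
    measurable_fun setT f -> lint (fun x => expR (- b * V x + b / 2 * `|f x|)).
  move=> fV mf; have := lintZ (expR (b / 2 * `|d|)) (iV b20); apply: lint_le.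
    apply: measurableT_comp => //; apply: measurable_funD; first exact: measurable_funM.
    by apply: measurable_funM => //; exact: measurableT_comp.
  move=> x; rewrite ger0_norm ?expR_ge0// -expRD ler_expR.
  by have := ler_wpM2l (ltW b20) (fV x); lra.
have mbV : measurable_fun setT (fun x => - b * V x) by exact: measurable_funM.
have same (f g : R -> R) (x : R) : (forall y, f y = g y) ->
    \int[leb]_y expR (f y) < x -> \int[leb]_y expR (g y) < x.
  by move=> fg; under eq_Rintegral do rewrite fg.
split.
  have mc : measurable_fun setT (fun x => V x - c) by exact: measurable_funB.
  have ic : lint (fun x => expR (- b * V x + b / 2 * `|V x - c|)).
    by apply: (itilt c) => // x; rewrite (le_trans (ler_normB _ _))// ger0_norm.
  have [t t01 tZ] := tilt_decrease mbV mc b20 ic Dc.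
  by exists t => //; apply: same tZ => x; ring.
have ma : measurable_fun setT (fun x => a - V x) by exact: measurable_funB.
have ia : lint (fun x => expR (- b * V x + b / 2 * `|a - V x|)).
  by apply: (itilt a) => // x; rewrite (le_trans (ler_normB _ _))// addrC ger0_norm.
have Da' : \int[leb]_x ((a - V x) * expR (- b * V x)) < 0.
  have -> : \int[leb]_x ((a - V x) * expR (- b * V x)) = (-1) * D b a.
    rewrite /Dv -LIZ; last by apply: lint_Dv => //; lra.
    by apply: eq_Rintegral => x _; ring.
  by rewrite mulN1r oppr_lt0.
have [t t01 tZ] := tilt_decrease mbV ma b20 ia Da'.
by exists t => //; apply: same tZ => x; ring.
Qed.

(* Under the Gibbs measure e^(-bV)/Z the mean of V lies strictly between [a]
   and [c], so the sum of the V(x_i) concentrates on [a n, c n]. *)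
Lemma svol_lower b a c : 0 < b -> 0 < D b a -> D b c < 0 ->
  \forall n \near \oo, Z b ^+ n * expR (b * a * n%:R) / 2 <= svol V n (c * n%:R).
Proof.
move=> b0 Da Dc; have b20 : b / 2 > 0 by rewrite divr_gt0.
have [[t /andP[t0 tb]] tZ [u /andP[u0 ub] uZ]] := tilted b20 Dc Da.
have maff p q : measurable_fun setT (fun x => p * V x + q).
  by apply: measurable_funD => //; exact: measurable_funM.
have iaff p q : p < 0 -> lint (fun x => expR (p * V x + q)).
  move=> p0; have := @iV (- p); rewrite oppr_gt0 => /(_ p0)/(lintZ (expR q)).
  by congr lint; apply/funext => x; rewrite -expRD opprK addrC.
have tb0 : t - b < 0 by lra.
have ub0 : - u - b < 0 by lra.
have iE1 n := En_exp n (maff (t - b) (- t * c)) (iaff _ _ tb0).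
have iE2 n := En_exp n (maff (- u - b) (u * a)) (iaff _ _ ub0).
have Jp f : 0 <= \int[leb]_x expR (f x) :> R by apply: LI_ge0 => x; exact: expR_ge0.
have J10 := Jp (fun x => (t - b) * V x + - t * c).
have J20 := Jp (fun x => (- u - b) * V x + u * a).
set J1 := Rintegral _ _ _ in tZ iE1 J10; set J2 := Rintegral _ _ _ in uZ iE2 J20.
clearbody J1 J2.
have e4 : 0 < 4^-1 :> R by rewrite invr_gt0.
near=> n.
have n1 : J1 ^+ n <= 4^-1 * Z b ^+ n by near: n; exact: near_geometric.
have n2 : J2 ^+ n <= 4^-1 * Z b ^+ n by near: n; exact: near_geometric.
have [i1 E1] := iE1 n; have [i2 E2] := iE2 n.
have [i3 E3] := En_exp n (measurable_funM (measurable_cst (- b)) mV) (iV b0).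
have i4 := integr_sublevel mV iV1 n (c * n%:R).
(* The first two exponentials cover the sums above cn and below an and contribute at most Z^n / 4
   each; the indicator covers the window between, where e^(-b sum V) <= e^(-ban). This is the origin
   of the factor 1/2. *)
have : En n (fun s => expR (\sum_(x <- s) - b * V x)) <=
    En n (fun s => (expR (\sum_(x <- s) ((t - b) * V x + - t * c)) +
      expR (\sum_(x <- s) ((- u - b) * V x + u * a))) +
      expR (- (b * a * n%:R)) * \1_(sublevel V (c * n%:R)) s).
  apply: En_le => //; first by apply: integrD; [exact: integrD|exact: integrZ].
  move=> s sn; rewrite !sum_affine sn -mulr_sumr sublevelE.
  move: (\sum_(x <- s) V x) => S.
  have [Sc|Sc] := leP S (c * n%:R); last first.
    rewrite mulr0 addr0 ler_wpDr ?expR_ge0// ler_expR.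
    by have := ler_wpM2l (ltW t0) (ltW Sc); lra.
  rewrite mulr1; have [Sa|Sa] := leP (a * n%:R) S.
    rewrite ler_wpDl ?addr_ge0 ?expR_ge0// ler_expR.
    by have := ler_wpM2l (ltW b0) Sa; lra.
  rewrite ler_wpDr ?expR_ge0// ler_wpDl ?expR_ge0// ler_expR.
  by have := ler_wpM2l (ltW u0) (ltW Sa); lra.
rewrite EnD; [|exact: integrD|exact: integrZ].
rewrite EnD// EnZ// E1 E2 E3 -/(svol V n _) -/(Z b) => H.
have : 2^-1 * Z b ^+ n <= expR (- (b * a * n%:R)) * svol V n (c * n%:R) by lra.
move=> /(ler_wpM2l (expR_ge0 (b * a * n%:R))).
rewrite [leRHS]mulrA -expRD subrr expR0 mul1r; lra.
Unshelve. all: by end_near. Qed.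

Section slopes.
Variables (r beta : R).
Hypotheses (r0 : 0 < r) (beta0 : 0 < beta) (Dr : D beta r = 0).

Let lcS n : log_concave (svol V n) := @log_concave_svol _ _ oV iV1 n.
Let S_mono n s t (h : s <= t) : svol V n s <= svol V n t := le_svol mV iV1 n h.
Let S_ge0 n t := svol_ge0 V n t.

Let D_right b : beta < b -> D b r < 0.
Proof. by move=> bb; apply: (Dv_strict oV iV beta0 bb r0); rewrite Dr. Qed.

Let D_left b : 0 < b -> b < beta -> 0 < D b r.
Proof.
move=> b0 bb; rewrite ltNge; apply/negP => Db.
by have := Dv_strict oV iV b0 bb r0 Db; rewrite Dr ltxx.
Qed.

(** At a parameter b between b1 and beta the Gibbs mean is r + m with m > 0. The lower bound at p =
    (r + m + d)n and the Chernoff bound at q = rn + C use the same b, so Z(b)^n cancels and the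
    secant over [q, p] has slope at least b1; [slope_left] carries this to everything left of q. *)
Lemma svol_slope_left b1 C : 0 < b1 -> b1 < beta ->
  \forall n \near \oo, forall s t, s <= t -> t <= r * n%:R + C ->
    svol V n s <= svol V n t * expR (- (b1 * (t - s))).
Proof.
move=> b10 b1b; pose b := (b1 + beta) / 2.
have b1b' : b1 < b by rewrite /b; lra.
have bbeta : b < beta by rewrite /b; lra.
have bp : 0 < b by lra.
have Zp := Zf_gt0 oV iV bp.
have Db := D_left bp bbeta.
pose m := D b r / Z b; have m0 : 0 < m by rewrite divr_gt0.
have mE : D b r = m * Z b by rewrite /m divfK// gt_eqF.
(* The gain b(m - d) must exceed b1(m + d), that is d(b + b1) < m(b - b1); d is half the threshold,
   and the remaining linear term absorbs C and the factor 1/2. *)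
clearbody m; pose d := m * (b - b1) / (2 * (b + b1)).
have d0 : 0 < d by rewrite divr_gt0 ?mulr_gt0//; lra.
have dE : d * (b + b1) = m * (b - b1) / 2 by rewrite /d; field; lra.
clearbody d.
have Da : 0 < D b (r + (m - d)).
  by rewrite Dv_shift// mE -mulrBl mulr_gt0//; lra.
have Dc : D b (r + (m + d)) < 0.
  by rewrite Dv_shift// mE -mulrBl pmulr_llt0//; lra.
near=> n.
have low : Z b ^+ n * expR (b * (r + (m - d)) * n%:R) / 2 <= svol V n ((r + (m + d)) * n%:R).
  by near: n; exact: svol_lower.
have big1 : C + 1 <= (m + d) * n%:R by near: n; apply: near_ge_mul; rewrite addr_gt0.
have big2 : b * C + 2 - b1 * C <= (m * (b - b1) / 2) * n%:R.
  by near: n; apply: near_ge_mul; rewrite divr_gt0 ?mulr_gt0//; lra.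
move=> s t st tq; set q := r * n%:R + C in tq.
have [Sq|Sq] := ltP 0 (svol V n q); last first.
  by rewrite (le_trans (S_mono n (le_trans st tq)))// (le_trans Sq)// mulr_ge0 ?expR_ge0 ?S_ge0.
pose p := (r + (m + d)) * n%:R; have qp : q < p by rewrite /q /p; lra.
have H := @slope_left _ _ (@lcS n) (@S_mono n) (@S_ge0 n) b1 s t q p.
apply: H => //; rewrite /p.

apply: le_trans low; apply: (le_trans (ler_wpM2r (expR_ge0 _) (svol_upper n q bp))).
rewrite mulrC mulrA -expRD.
have e2 : expR (-1) <= 2^-1 :> R.
  by rewrite expRN lef_pV2 ?posrE ?expR_gt0//; have := expR_ge1Dx (1 : R); lra.
apply: (@le_trans _ _ (Z b ^+ n * expR (b * (r + (m - d)) * n%:R) * expR (-1)));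
  last first.
  by rewrite ler_wpM2l// mulr_ge0 ?expR_ge0 ?exprn_ge0// ltW.
rewrite -mulrA -expRD mulrC ler_wpM2l ?exprn_ge0 ?(ltW Zp)// ler_expR /q.
have := congr1 (fun z => z * n%:R) dE; rewrite /=; lra.
Unshelve. all: by end_near. Qed.

(** Mirror image: for b between beta and b2 the Gibbs mean is r - m, and the secant runs from q = (r
    - m + d)n to p = rn - C, the condition d < m keeping q to the left of p. *)
Lemma svol_slope_right b2 C : beta < b2 ->
  \forall n \near \oo, forall s t, r * n%:R - C <= s -> s <= t ->
    svol V n t <= svol V n s * expR (b2 * (t - s)).
Proof.
move=> bb2; pose b := (b2 + beta) / 2.
have b2b' : b < b2 by rewrite /b; lra.
have bbeta : beta < b by rewrite /b; lra.
have bp : 0 < b by rewrite (lt_trans beta0).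
clearbody b.
have Zp := Zf_gt0 oV iV bp.
have Db := D_right bbeta.
pose m := - D b r / Z b; have m0 : 0 < m by rewrite divr_gt0// oppr_gt0.
have mE : D b r = - m * Z b by rewrite /m mulNr divfK ?gt_eqF// opprK.
clearbody m; pose d := m * (b2 - b) / (2 * (b + b2)).
have d0 : 0 < d by rewrite divr_gt0 ?mulr_gt0//; lra.
have dE : d * (b + b2) = m * (b2 - b) / 2 by rewrite /d; field; lra.
clearbody d.
have dm : d < m.
  have h : d * (b + b2) < m * (b + b2) by rewrite dE; have := mulr_gt0 m0 bp;
    have := mulr_gt0 m0 (lt_trans bp b2b'); lra.
  have bb2' : 0 < b + b2 by lra.
  by rewrite -(ltr_pM2r bb2').
have Da : 0 < D b (r + (- m - d)).
  by rewrite Dv_shift// mE -mulrBl mulr_gt0//; lra.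
have Dc : D b (r + (- m + d)) < 0.
  by rewrite Dv_shift// mE -mulrBl pmulr_llt0//; lra.
near=> n.
have low : Z b ^+ n * expR (b * (r + (- m - d)) * n%:R) / 2 <= svol V n ((r + (- m + d)) * n%:R).
  by near: n; exact: svol_lower.
have big1 : C + 1 <= (m - d) * n%:R by near: n; apply: near_ge_mul; rewrite subr_gt0.
have big2 : b2 * C + 2 - b * C <= (m * (b2 - b) / 2) * n%:R.
  by near: n; apply: near_ge_mul; rewrite divr_gt0 ?mulr_gt0//; lra.
move=> s t ps st; set p := r * n%:R - C in ps.
set q := (r + (- m + d)) * n%:R in low.
have Sq : 0 < svol V n q.
  by rewrite (lt_le_trans _ low)// divr_gt0// mulr_gt0 ?expR_gt0 ?exprn_gt0.
have qp : q < p by rewrite /q /p; lra.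
have H := @slope_right _ _ (@lcS n) (@S_mono n) b2 q p s t.
apply: H => //.
apply: (le_trans (svol_upper n p bp)).
apply: le_trans (ler_wpM2r (expR_ge0 _) low).
have e2 : expR (-1) <= 2^-1 :> R.
  by rewrite expRN lef_pV2 ?posrE ?expR_gt0//; have := expR_ge1Dx (1 : R); lra.
apply: (@le_trans _ _ (Z b ^+ n * expR (b * (r + (- m - d)) * n%:R) * expR (-1) *
    expR (b2 * (p - q)))); last first.
  by rewrite ler_wpM2r ?expR_ge0// ler_wpM2l// mulr_ge0 ?expR_ge0 ?exprn_ge0// ltW.
rewrite -!mulrA -!expRD mulrC ler_wpM2l ?exprn_ge0 ?(ltW Zp)// ler_expR /q /p.
have := congr1 (fun z => z * n%:R) dE; rewrite /=; lra.
Unshelve. all: by end_near. Qed.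

Lemma svol_exact_lower k : 0 < k ->
  \forall n \near \oo, Z beta ^+ n * expR ((beta * r - k) * n%:R) <= svol V n (r * n%:R).
Proof.
(* The window [r - d, r + d] costs beta d = k / 4 and the descent from (r + d)n to rn with slope 2
   beta costs k / 2; the last k / 4 absorbs the factor 1/2. *)
move=> k0; pose d := k / (4 * beta).
have d0 : 0 < d by rewrite divr_gt0// mulr_gt0.
have bd : beta * d = k / 4 by rewrite /d; field; rewrite gt_eqF.
clearbody d.
have Zp := Zf_gt0 oV iV beta0.
have Da : 0 < D beta (r - d) by rewrite Dv_shift// Dr sub0r mulNr opprK mulr_gt0.
have Dc : D beta (r + d) < 0 by rewrite Dv_shift// Dr sub0r oppr_lt0 mulr_gt0.
have b2 : beta < 2 * beta by rewrite ltr_pMl// ltr1n.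
near=> n.
have low : Z beta ^+ n * expR (beta * (r - d) * n%:R) / 2 <= svol V n ((r + d) * n%:R).
  by near: n; exact: svol_lower.
have big : 1 <= (k / 4) * n%:R by near: n; apply: near_ge_mul; rewrite divr_gt0.
have slope : forall s t, r * n%:R - 0 <= s -> s <= t ->
    svol V n t <= svol V n s * expR (2 * beta * (t - s)).
  by near: n; exact: svol_slope_right.
have := slope (r * n%:R) ((r + d) * n%:R); rewrite subr0 lexx => /(_ isT).
have dn : 0 <= d * n%:R by rewrite mulr_ge0// ltW.
rewrite (_ : r * n%:R <= _); last by lra.
move=> /(_ isT)/(le_trans low)/(ler_wpM2r (expR_ge0 (- (2 * beta * (d * n%:R))))).
rewrite -[leRHS]mulrA -expRD (_ : 2 * beta * _ + _ = 0); last by ring.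
rewrite expR0 mulr1; apply: le_trans.
have e2 : expR (-1) <= 2^-1 :> R.
  by rewrite expRN lef_pV2 ?posrE ?expR_gt0//; have := expR_ge1Dx (1 : R); lra.
apply: (@le_trans _ _ (Z beta ^+ n * expR (beta * (r - d) * n%:R) * expR (-1) *
    expR (- (2 * beta * (d * n%:R))))); last first.
  by rewrite ler_wpM2r ?expR_ge0// ler_wpM2l// mulr_ge0 ?expR_ge0 ?exprn_ge0// ltW.
rewrite -!mulrA -!expRD ler_wpM2l ?exprn_ge0 ?(ltW Zp)// ler_expR.
have := congr1 (fun z => z * n%:R) bd; rewrite /=; lra.
Unshelve. all: by end_near. Qed.

End slopes.
End sublevel_asymptotics.

(** * Integrals of additive functions over sublevel sets *)

Section additive_observable.
Variable R : realType.
Notation leb := (@lebesgue_measure R).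
Variable V : R -> R.
Hypothesis oV : orlicz V.
Hypothesis iV : lint (fun x => expR (- V x)).
Let mV := orlicz_measurable oV.
Let V0 := orlicz_ge0 oV.
Variable psi : R -> R.
Hypothesis mpsi : measurable_fun setT psi.
Hypothesis psi0 : forall x, 0 <= psi x.
Hypothesis ipsi : lint (fun x => psi x * expR (- V x)).

Let F t s := \1_(sublevel V t) s * \sum_(x <- s) psi x.

Let mF n t : meas n (F t).
Proof. by apply: measurable_funM; [exact: meas_sublevel|exact: measurable_sumV]. Qed.

Let F0 t s : 0 <= F t s.
Proof. by rewrite mulr_ge0 ?sublevel_ge0// sumr_ge0. Qed.

Let msvol n t : measurable_fun setT (fun x => svol V n (t - V x)).
Proof.
by apply: (measurableT_comp (measurable_svol mV iV n)); exact: measurable_funB.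
Qed.

Let svol_succE n t : (\int[leb]_x (svol V n (t - V x))%:E = (svol V n.+1 t)%:E)%E.
Proof.
have [-> fi] := svol_succ mV iV n t.
by rewrite /Rintegral fineK//; exact: (integrable_fin_num _ fi).
Qed.

(* By symmetry of Lebesgue measure every coordinate contributes the same. *)
Let integral_additive n t : (\int[mu n]_p (F t (sq n p))%:E =
  n%:R%:E * \int[leb]_x (psi x * svol V n.-1 (t - V x))%:E)%E.
Proof.
elim: n t => [|n ih] t.
  by rewrite (integral_mu0 (EFin \o F t)) /= /F big_nil mulr0 mul0e.
rewrite (integral_mu_succ (@mF n.+1 t) (@F0 t)).
have E x : (\int[mu n]_q (F t (x :: sq n q))%:E =
    (psi x * svol V n (t - V x))%:E + \int[mu n]_q (F (t - V x) (sq n q))%:E)%E.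
  have i1 := integr_sublevel mV iV n (t - V x).
  rewrite EFinM [X in (_ * X)%E]EnE//.
  have i1' := meas_EFin (integr_meas i1).
  have s0 p : (0 <= (\1_(sublevel V (t - V x)) (sq n p))%:E :> \bar R)%E.
    by rewrite lee_fin sublevel_ge0.
  have F0' p : (0 <= (F (t - V x) (sq n p))%:E)%E by rewrite lee_fin F0.
  have mF' := meas_EFin (@mF n (t - V x)).
  rewrite -ge0_integralZl_EFin// -ge0_integralD//.
  - apply: eq_integral => p _; rewrite /F big_cons sublevel_cons -EFinM -EFinD; congr EFin.
    by ring.
  - by move=> p _; rewrite mule_ge0// lee_fin.
  - exact: measurable_funeM.
transitivity (\int[leb]_x ((psi x * svol V n (t - V x))%:E +
    \int[mu n]_q (F (t - V x) (sq n q))%:E))%E.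
  by apply: eq_integral => x _; exact: E.
(* z.1 is the coordinate peeled off and z.2 the one carrying psi. Exchanging the integrals absorbs
   z.1 into the volume and raises its dimension by one. *)
pose g (z : measurableTypeR R * measurableTypeR R) :=
  (psi z.2 * svol V n.-1 (t - V z.1 - V z.2))%:E.
have g0 z : (0 <= g z)%E by rewrite lee_fin mulr_ge0// svol_ge0.
have mg : measurable_fun setT g.
  apply/measurable_EFinP; apply: measurable_funM.
    exact: (measurableT_comp mpsi measurable_snd).
  apply: (measurableT_comp (measurable_svol mV iV n.-1)).
  apply: measurable_funB; last exact: (measurableT_comp mV measurable_snd).
  by apply: measurable_funB => //; exact: (measurableT_comp mV measurable_fst).
have m1 := measurable_fun_fubini_tonelli_F (m2 := leb) g mg g0.
have mI : measurable_fun setT (fun x => \int[mu n]_q (F (t - V x) (sq n q))%:E)%E.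
  under eq_fun do rewrite ih.
  exact: measurable_funeM.
have I0 t' : (0 <= \int[mu n]_q (F t' (sq n q))%:E)%E.
  by apply: integral_ge0 => p _; rewrite lee_fin F0.
have p0 x : (0 <= (psi x * svol V n (t - V x))%:E)%E by rewrite lee_fin mulr_ge0// svol_ge0.
have mp : measurable_fun setT (fun x => (psi x * svol V n (t - V x))%:E).
  by apply/measurable_EFinP; exact: measurable_funM.
rewrite ge0_integralD//.
(* For n = 0 the truncated predecessor [n.-1] is meaningless, but the second term vanishes. *)
case: n ih E @g g0 mg m1 mI I0 p0 mp => [|n] ih E g g0 mg m1 mI I0 p0 mp.
  rewrite [X in (_ + X)%E]integral0_eq ?adde0 ?mul1e// => x _.
  by rewrite (integral_mu0 (EFin \o F _)) /= /F big_nil mulr0.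
rewrite [X in (_ + X)%E](_ : _ = (n.+1%:R%:E * \int[leb]_x fubini_F leb g x)%E); last first.
  rewrite -ge0_integralZl_EFin//; last first.
    by move=> x _; apply: integral_ge0.
  by apply: eq_integral => x _; rewrite ih.
have -> : (\int[leb]_x fubini_F leb g x = \int[leb]_x (psi x * svol V n.+1 (t - V x))%:E)%E.
  rewrite [LHS](fubini_tonelli (m1 := leb) (m2 := leb) g mg g0).
  apply: eq_integral => y _; rewrite /g /=.
  under eq_integral do rewrite EFinM.
  rewrite ge0_integralZl_EFin//.
  - rewrite EFinM -svol_succE; congr (_ * _)%E; apply: eq_integral => x _.
    by congr (svol V n _)%:E; ring.
  - by move=> x _; rewrite lee_fin svol_ge0.
  - apply/measurable_EFinP; apply: (measurableT_comp (measurable_svol mV iV n)).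
    by apply: measurable_funB => //; exact: measurable_funB.
by rewrite -[X in (X + _)%E]mul1e -ge0_muleDl.
Qed.

Lemma En_additive n t :
  [/\ integr n.+1 (fun s => \1_(sublevel V t) s * \sum_(x <- s) psi x),
      lint (fun x => psi x * svol V n (t - V x)) &
      En n.+1 (fun s => \1_(sublevel V t) s * \sum_(x <- s) psi x) =
        n.+1%:R * \int[leb]_x (psi x * svol V n (t - V x))].
Proof.
have i1 : lint (fun x => psi x * svol V n (t - V x)).
  (* The slice volume vanishes where V x > t and is at most [svol V n t] elsewhere, so it is below
     [svol V n t * expR (t - V x)]. *)
  have := lintZ (svol V n t * expR t) ipsi; apply: lint_le.
    exact: measurable_funM.
  move=> x; rewrite ger0_norm ?mulr_ge0 ?svol_ge0// mulrCA ler_wpM2l//.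
  have [Vt|Vt] := leP (V x) t; last first.
    by rewrite svol_neg ?subr_lt0// !mulr_ge0 ?expR_ge0 ?svol_ge0.
  rewrite -mulrA -expRD -[leLHS]mulr1 ler_pM ?svol_ge0//.
    by apply: le_svol => //; rewrite gerBl.
  by rewrite -expR0 ler_expR subr_ge0.
have E : (\int[mu n.+1]_p (F t (sq n.+1 p))%:E =
    (n.+1%:R * \int[leb]_x (psi x * svol V n (t - V x)))%:E)%E.
  by rewrite integral_additive EFinM /Rintegral fineK//; exact: (integrable_fin_num _ i1).
split => //; last by rewrite /En /Rintegral E.
apply/integrableP; split; first exact: (meas_EFin (@mF n.+1 t)).
rewrite (eq_integral (fun p => (F t (sq n.+1 p))%:E)) ?E ?ltry// => p _.
by rewrite /= ger0_norm ?F0.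
Qed.
End additive_observable.

(** * The second constraint is asymptotically satisfied *)

Section constraint_inactive.
Variable R : realType.
Notation leb := (@lebesgue_measure R).
Variables V W : R -> R.
Hypotheses (oV : orlicz V) (oW : orlicz W).
Hypothesis iV : forall b, 0 < b -> lint (fun x => expR (- b * V x)).
Hypothesis iW : forall b, 0 < b -> lint (fun x => W x * expR (- b * V x)).
Let mV := orlicz_measurable oV.
Let mW := orlicz_measurable oW.
Let V0 := orlicz_ge0 oV.
Let W0 := orlicz_ge0 oW.
Let iV1 := lint_exp1 iV.
Notation Z := (Zf V).
Notation D := (Dv V).

Let phi M x := Num.min (W x) M.
Let psi M x := W x - phi M x.

Let mphi M : measurable_fun setT (phi M).
Proof. exact: measurable_minr. Qed.

Let mpsi M : measurable_fun setT (psi M).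
Proof. exact: measurable_funB. Qed.

Let psi0 M x : 0 <= psi M x.
Proof. by rewrite subr_ge0 ge_min lexx. Qed.

Let phi_bound M x : 0 <= M -> 0 <= phi M x <= M.
Proof. by move=> M0; rewrite le_min W0 M0/= ge_min lexx orbT. Qed.

Let psi_le M x : 0 <= M -> psi M x <= W x.
Proof. by move=> M0; rewrite gerBl; case/andP: (phi_bound x M0). Qed.

Let ipsi M b : 0 <= M -> 0 < b -> lint (fun x => psi M x * expR (- b * V x)).
Proof.
move=> M0 b0; have := iW b0; apply: lint_le.
  apply: measurable_funM => //; apply: measurableT_comp => //; exact: measurable_funM.
by move=> x; rewrite ger0_norm ?mulr_ge0 ?expR_ge0// ler_wpM2r ?expR_ge0// psi_le.
Qed.

(** Dominated convergence along integer truncation levels: at each x the excess is eventually 0. *)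
Lemma truncation_tail b e : 0 < b -> 0 < e ->
  exists2 M, 0 <= M & \int[leb]_x ((W x - Num.min (W x) M) * expR (- b * V x)) <= e.
Proof.
move=> b0 e0.
pose f n x : \bar R := (psi n%:R x * expR (- b * V x))%:E.
have fn n := ipsi (ler0n R n) b0.
have mf n : measurable_fun setT (f n) by exact: measurable_int (fn n).
have [] := @dominated_convergence _ _ R leb setT measurableT f (cst 0%E)
  (EFin \o (fun x => W x * expR (- b * V x))) mf (measurable_cst _) _ (iW b0) _.
- apply/aeW => x _; apply: cvg_near_cst.
  near=> n; rewrite /f /psi /phi min_l ?subrr ?mul0r//.
  by near: n; exact: nbhs_infty_ger.
- apply/aeW => x n _; rewrite /f gee0_abs ?lee_fin ?mulr_ge0 ?expR_ge0//.
  by rewrite ler_wpM2r ?expR_ge0// psi_le.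
move=> _ _; rewrite integral0 => /fine_cvgP[_ /cvgrPdist_le/(_ _ e0)[n _ /(_ n (leqnn n))/=]].
rewrite sub0r normrN => H; exists n%:R => //.
by rewrite (le_trans _ H)// ler_norm.
Unshelve. all: by end_near. Qed.

Let bool_mul_le t s (b : bool) : `|\1_(sublevel V t) s * b%:R| <= 1 * \1_(sublevel V t) s :> R.
Proof.
rewrite mul1r ger0_norm ?mulr_ge0 ?sublevel_ge0//.
by rewrite -[leRHS]mulr1 ler_wpM2l ?sublevel_ge0//; case: b.
Qed.

Let integr_excess n t (U : R -> R) c : measurable_fun setT U ->
  integr n (fun s => \1_(sublevel V t) s * (1 - \1_(sublevel U c) s)).
Proof.
move=> mU; apply: (@bounded_integr _ _ mV iV1 _ _ 1 t).
  apply: measurable_funM; first exact: meas_sublevel.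
  by apply: measurable_funB => //; exact: (@meas_sublevel _ _ mU n c).
move=> s; have := bool_mul_le t s (~~ (\sum_(x <- s) U x <= c)).
by rewrite [X in 1 - X]sublevelE; case: (_ <= c); rewrite /= ?subrr ?subr0.
Qed.

Let integr_truncated M n t c :
  integr n (fun s => \1_(sublevel V t) s * (c < \sum_(x <- s) phi M x)%R%:R).
Proof.
have := @integr_excess n t (phi M) c (@mphi M); apply: integr_eq => s _.
by rewrite [X in 1 - X]sublevelE ltNge; case: (_ <= c); rewrite /= ?subrr ?subr0.
Qed.

Section at_level.
Variables (r beta : R).
Hypotheses (r0 : 0 < r) (beta0 : 0 < beta) (Dr : D beta r = 0).
Hypothesis meanW : \int[leb]_x (W x * expR (- beta * V x)) <= Z beta / 4.

Let Zp := Zf_gt0 oV iV beta0.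

(** The Gibbs mean of the truncated function is at most 1/4, so a tilt towards sums above n / 2
    lowers the partition function from Z to some J < Z, and Chernoff gives a bound of order J^n. *)
Let truncated_part M e : 0 <= M -> 0 < e -> \forall n \near \oo,
  En n (fun s => \1_(sublevel V (r * n%:R)) s * (n%:R / 2 < \sum_(x <- s) phi M x)%R%:R) <=
    e * svol V n (r * n%:R).
Proof.
move=> M0 e0.
have mf : measurable_fun setT (fun x => phi M x - 2^-1) by exact: measurable_funB.
have mh : measurable_fun setT (fun x => - beta * V x) by exact: measurable_funM.
have fb x : `|phi M x - 2^-1| <= M + 2^-1.
  have /andP[p1 p2] := phi_bound x M0.
  by rewrite (le_trans (ler_normB _ _))// !ger0_norm ?lerD2r.
have i1 : lint (fun x => expR (- beta * V x + 1 * `|phi M x - 2^-1|)).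
  have := lintZ (expR (M + 2^-1)) (iV beta0); apply: lint_le.
    apply: measurableT_comp => //; apply: measurable_funD => //.
    by apply: measurable_funM => //; exact: measurableT_comp.
  by move=> x; rewrite ger0_norm ?expR_ge0// -expRD ler_expR addrC lerD2r mul1r.
have neg : \int[leb]_x ((phi M x - 2^-1) * expR (- beta * V x)) < 0.
  apply: (@le_lt_trans _ _ (Z beta / 4 - 2^-1 * Z beta)); last by have := Zp; lra.
  apply: le_trans (lerB meanW (lexx _)).
  rewrite /Zf -LIZ; last exact: iV.
  rewrite -LIB; [|exact: iW|exact/lintZ/iV].
  apply: LI_le.
  - exact: (lint_tilt_mul mh mf ltr01 i1).
  - by apply: lintB; [exact: iW|exact/lintZ/iV].
  - by move=> x; rewrite -mulrBl ler_wpM2r ?expR_ge0// lerD2r ge_min lexx.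
have [t /andP[t0 t1] tZ] := tilt_decrease mh mf ltr01 i1 neg.
set J := Rintegral _ _ _ in tZ; rewrite -/(Z beta) in tZ.
have J0 : 0 <= J by apply: LI_ge0 => x; exact: expR_ge0.
(* The volume is known only up to e^(-kn). An intermediate J' = Z e^(-k) absorbs this loss and still
   leaves J^n <= e J'^n. *)
pose J' := (J + Z beta) / 2.
have JJ' : J < J' by rewrite /J'; lra.
have J'Z : J' < Z beta by rewrite /J'; lra.
have J'0 : 0 < J' by rewrite (le_lt_trans J0).
pose k := ln (Z beta / J').
have k0 : 0 < k by rewrite ln_gt0// ltr_pdivlMr// mul1r.
have kE : J' = Z beta * expR (- k).
  have ZJ : 0 < Z beta / J' by exact: divr_gt0.
  by rewrite expRN /k lnK ?posrE// invf_div mulrC divfK// gt_eqF.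
near=> n.
have low : Z beta ^+ n * expR ((beta * r - k) * n%:R) <= svol V n (r * n%:R).
  by near: n; exact: (svol_exact_lower oV iV r0 beta0 Dr).
have geo : J ^+ n <= e * J' ^+ n by near: n; exact: near_geometric.
have it : lint (fun x => expR (- beta * V x + t * (phi M x - 2^-1))).
  by apply: (lint_tilt mh mf i1); rewrite ger0_norm// ltW.
have mt : measurable_fun setT (fun x => - beta * V x + t * (phi M x - 2^-1)).
  by apply: measurable_funD => //; exact: measurable_funM.
have := En_chernoff (c := beta * (r * n%:R)) mt it (@integr_truncated M n (r * n%:R) (n%:R / 2)).
rewrite -/J => H; apply: le_trans (H _) _ => {H}.
  move=> s sn; rewrite sublevelE.
  case: (leP _ (r * n%:R)) => /= [Sr|_]; last by rewrite mul0r mulr_ge0 ?expR_ge0.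
  case: (ltP (n%:R / 2)) => /= [Sp|_]; last by rewrite mulr0 mulr_ge0 ?expR_ge0.
  rewrite mulr1 -expRD -[X in X <= _]expR0 ler_expR big_split/= -!mulr_sumr.
  have := sum_affine (phi M) 1 (- 2^-1) s.
  under eq_bigr do rewrite mul1r; rewrite sn mul1r mulNr => ->.
  have := ler_wpM2l (ltW beta0) Sr; have := ler_wpM2l (ltW t0) (ltW Sp); lra.
apply: le_trans (ler_wpM2l (ltW e0) low).
apply: le_trans (ler_wpM2l (expR_ge0 _) geo) _.
rewrite kE exprMn mulrCA ler_wpM2l ?(ltW e0)// mulrCA ler_wpM2l ?exprn_ge0 ?(ltW Zp)//.
by rewrite -expRM_natl -expRD ler_expR; lra.
Unshelve. all: by end_near. Qed.

(** No exponential moment of the excess is available, so only its mean is estimated. The left slope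
    bounds the slice volume at x by e^(-beta V x / 2) times that at 0, reducing the mean to a
    one-dimensional integral that a large M makes small. *)
Let tail_part e : 0 < e -> exists2 M, 0 <= M & \forall n \near \oo,
  integr n.+1 (fun s => \1_(sublevel V (r * n.+1%:R)) s * \sum_(x <- s) psi M x) /\
  En n.+1 (fun s => \1_(sublevel V (r * n.+1%:R)) s * \sum_(x <- s) psi M x) <=
    n.+1%:R * (e * svol V n.+1 (r * n.+1%:R)).
Proof.
move=> e0; have [a /andP[a0 _] Va] := orlicz_small oV (@ltr01 R).
(* Lower bound for the ratio of the volumes in dimensions n + 1 and n at the same level: the extra
   coordinate is kept in [-a, a], where V <= 1, and the right slope 2 beta bounds the loss. *)
pose k := 2 * a * expR (- (2 * beta)).
have k0 : 0 < k by rewrite !mulr_gt0 ?expR_gt0.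
have b20 : 0 < beta / 2 by rewrite divr_gt0.
have [M M0 HM] := truncation_tail b20 (mulr_gt0 e0 k0).
exists M => //; near=> n.
have sl : forall s t : R, s <= t -> t <= r * n%:R + r ->
    svol V n s <= svol V n t * expR (- (beta / 2 * (t - s))).
  near: n. apply: (svol_slope_left oV iV r0 Dr) => //.
  by rewrite ltr_pdivrMr// ltr_pMr// ltr1n.
have sr : forall s t : R, r * n%:R - 1 <= s -> s <= t ->
    svol V n t <= svol V n s * expR (2 * beta * (t - s)).
  near: n; apply: (svol_slope_right oV iV r0 beta0 Dr).
  by rewrite ltr_pMl// ltr1n.
set T := r * n.+1%:R; have TE : T = r * n%:R + r by rewrite /T -natr1 mulrDr mulr1.
have ipsi1 : lint (fun x => psi M x * expR (- V x)).
  by have := ipsi M0 (@ltr01 R); under eq_fun do rewrite mulN1r.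
have [i1 i2 ->] := En_additive oV iV1 (@mpsi M) (@psi0 M) ipsi1 n T.
split => //; rewrite ler_wpM2l//.
have [i3 i3E] := lint_indic_itv (ltW a0).
have low : k * svol V n T <= svol V n.+1 T.
  have [-> i4] := svol_succ mV iV1 n T.
  rewrite /k mulrAC -mulrA -i3E mulrC -LIZ//.
  apply: LI_le => //; first exact: lintZ.
  move=> x; rewrite indicE; case: (boolP (_ \in _)) => /= [|_]; last by rewrite mulr0 svol_ge0.
  rewrite inE/= in_itv/= -ler_norml mulr1 => /Va Vx.
  have TV : r * n%:R - 1 <= T - V x by rewrite TE; have := r0; lra.
  have := sr (T - V x) T TV; rewrite gerBl V0 opprB addrCA subrr addr0 => /(_ isT) H.
  have H2 : svol V n T <= svol V n (T - V x) * expR (2 * beta).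
    apply: (le_trans H); rewrite ler_wpM2l ?svol_ge0// ler_expR.
    by have := ler_wpM2l (ltW beta0) Vx; lra.
  have := ler_wpM2r (expR_ge0 (- (2 * beta))) H2.
  by rewrite -mulrA -expRD subrr expR0 mulr1 mulrC; apply.
apply: le_trans (ler_wpM2l (ltW e0) low).
apply: (@le_trans _ _ (svol V n T * \int[leb]_x (psi M x * expR (- (beta / 2) * V x)))).
  rewrite -LIZ; last exact: ipsi.
  apply: LI_le => //; first exact/lintZ/ipsi.
  move=> x; rewrite mulrCA ler_wpM2l//.
  have := sl (T - V x) T; rewrite gerBl V0 TE lexx => /(_ isT isT).
  by rewrite opprB addrCA subrr addr0 mulNr.
by rewrite mulrA [leRHS]mulrC ler_wpM2l ?svol_ge0.
Unshelve. all: by end_near. Qed.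

Lemma constraint_inactive e : 0 < e -> \forall n \near \oo,
  En n (fun s => \1_(sublevel V (r * n%:R)) s * (1 - \1_(sublevel W n%:R) s)) <=
    e * svol V n (r * n%:R).
Proof.
move=> e0; have e2 : 0 < e / 2 by rewrite divr_gt0.
have e4 : 0 < e / 4 by rewrite divr_gt0.
have [M M0 tail] := tail_part e4.
have trunc := truncated_part M0 e2.
suff [N _ HN] : \forall n \near \oo,
    En n.+1 (fun s => \1_(sublevel V (r * n.+1%:R)) s * (1 - \1_(sublevel W n.+1%:R) s)) <=
    e * svol V n.+1 (r * n.+1%:R).
  by exists N.+1 => // -[//|n] /= Nn; apply: HN.
have {trunc}trunc : \forall n \near \oo,
  En n.+1 (fun s => \1_(sublevel V (r * n.+1%:R)) s * (n.+1%:R / 2 < \sum_(x <- s) phi M x)%R%:R) <=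
    e / 2 * svol V n.+1 (r * n.+1%:R).
  by have [N _ HN] := trunc; exists N => // n /= Nn; apply: HN; exact: leqW.
near=> n.
have [i2 t2] : integr n.+1 (fun s => \1_(sublevel V (r * n.+1%:R)) s * \sum_(x <- s) psi M x) /\
  En n.+1 (fun s => \1_(sublevel V (r * n.+1%:R)) s * \sum_(x <- s) psi M x) <=
    n.+1%:R * (e / 4 * svol V n.+1 (r * n.+1%:R)) by near: n.
have t1 : En n.+1 (fun s => \1_(sublevel V (r * n.+1%:R)) s *
    (n.+1%:R / 2 < \sum_(x <- s) phi M x)%R%:R) <= e / 2 * svol V n.+1 (r * n.+1%:R).
  by near: n.
have i1 : integr n.+1 (fun s => \1_(sublevel V (r * n.+1%:R)) s *
    (n.+1%:R / 2 < \sum_(x <- s) phi M x)%R%:R).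
  exact: integr_truncated.
have i0 : integr n.+1 (fun s => \1_(sublevel V (r * n.+1%:R)) s * (1 - \1_(sublevel W n.+1%:R) s)).
  exact: integr_excess.
have np : 0 < n.+1%:R :> R by rewrite ltr0n.
have n0 : 0 < 2 / n.+1%:R :> R by rewrite divr_gt0.
(* If the sum of W exceeds n + 1, then the truncated sum exceeds half of this or the excess does.
   The second event is handled by Markov's inequality with factor 2 / (n + 1); both contribute e /
   2. *)
apply: (@le_trans _ _ (En n.+1 (fun s => \1_(sublevel V (r * n.+1%:R)) s *
    (n.+1%:R / 2 < \sum_(x <- s) phi M x)%R%:R + 2 / n.+1%:R *
   (\1_(sublevel V (r * n.+1%:R)) s * \sum_(x <- s) psi M x)))).
  apply: En_le => //; first by apply: integrD => //; exact: integrZ.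
  move=> s sn; rewrite mulrCA -mulrDr ler_wpM2l ?sublevel_ge0// sublevelE.
  have P0 : 0 <= \sum_(x <- s) psi M x by apply: sumr_ge0.
  have PW : \sum_(x <- s) W x = \sum_(x <- s) phi M x + \sum_(x <- s) psi M x.
    by rewrite -big_split/=; apply: eq_bigr => x _; rewrite /psi; ring.
  case: (leP (\sum_(x <- s) W x)) => /= Wn; first by rewrite subrr addr_ge0// mulr_ge0// ltW.
  rewrite subr0; case: ltP => /= Hphi; first by rewrite lerDl mulr_ge0// ltW.
  rewrite add0r mulrAC ler_pdivlMr// mul1r; lra.
rewrite EnD//; last exact: integrZ.
rewrite EnZ//; have := ler_wpM2l (ltW n0) t2.
rewrite [leRHS](_ : _ = 2 * (e / 4 * svol V n.+1 (r * n.+1%:R))); last by field; rewrite gt_eqF.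
move=> h; apply: le_trans (lerD t1 h) _.
by rewrite le_eqVlt; apply/orP; left; apply/eqP; field.
Unshelve. all: by end_near. Qed.

End at_level.
End constraint_inactive.

(** * Bounded Lipschitz test functions and their measurability *)

Section lipschitz_test_functions.
Variable R : realType.

Lemma row_norm_le_sum k (x : 'rV[R]_k) : `|x| <= \sum_(i < k) `|x ord0 i|.
Proof.
rewrite [leLHS]/Num.Def.normr/= mx_normrE bigmax_le ?sumr_ge0// => -[i j] _ /=.
by rewrite (ord1 i) (bigD1 j)//= lerDl sumr_ge0.
Qed.

Lemma BL1_const k c : `|c| <= 1 -> BL1 k (fun=> c : R).
Proof. by move=> c1; split => // x y; rewrite subrr normr0. Qed.

Lemma rat_row_near k (x : 'rV[R]_k) e : 0 < e ->
  exists q : 'rV[rat]_k, \sum_(i < k) `|x ord0 i - ratr (q ord0 i)| <= e.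
Proof.
move=> e0; have k0 : 0 < k.+1%:R :> R by rewrite ltr0n.
have d0 : 0 < e / k.+1%:R by rewrite divr_gt0.
have near_rat (d y : R) : 0 < d -> {q : rat | `|y - ratr q| <= d}.
  move=> {}d0; apply: cid; have /rat_in_itvoo[q] : y - d < y + d by lra.
  by rewrite in_itv/= => /andP[q1 q2]; exists q; rewrite ler_norml; lra.
exists (\row_i sval (near_rat _ (x ord0 i) d0)).
apply: (@le_trans _ _ (\sum_(i < k) e / k.+1%:R)).
  by apply: ler_sum => i _; rewrite mxE; exact: (svalP (near_rat _ _ _)).
rewrite sumr_const card_ord -[leLHS]mulr_natr mulrAC ler_pdivrMr//.
by rewrite ler_wpM2l ?ler_nat// ltW.
Qed.

(* McShane's formula, over a countable dense set of base points. *)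
Lemma measurable_BL1 d (T : measurableType d) k (g : 'rV[R]_k -> R) (c : T -> 'rV[R]_k) :
  BL1 k g -> (forall i, measurable_fun setT (fun t => c t ord0 i)) ->
  measurable_fun setT (fun t => g (c t)).
Proof.
move=> [g1 gL] mc.
pose base n : 'rV[R]_k := if unpickle n is Some q then map_mx ratr (q : 'rV[rat]_k) else 0.
pose h n t := g (base n) + \sum_(i < k) `|c t ord0 i - base n ord0 i|.
have hg n t : g (c t) <= h n t.
  rewrite /h -lerBlDl (le_trans (ler_norm _))// (le_trans (gL _ _))//.
  rewrite (le_trans (row_norm_le_sum _))//.
  by apply: ler_sum => i _; rewrite !mxE.
have lb t : has_lbound (range (h ^~ t)).
  by exists (g (c t)) => _ [n _ <-].
have mh n : measurable_fun setT (h n).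
  apply: measurable_funD => //; apply: measurable_sum => i.
  apply: measurableT_comp => //; exact: measurable_funB.
have := measurable_fun_infs 0 (fun t _ => lb t) mh.
apply: eq_measurable_fun => t _.
apply/le_anti/andP; split; last first.
  apply: lb_le_inf; first by exists (h 0 t), 0.
  by move=> _ [n _ <-].
apply/ler_addgt0Pr => e e0; have e20 : 0 < e / 2 by rewrite divr_gt0.
have [q qe] := rat_row_near (c t) e20.
have le_h : infs (h ^~ t) 0 <= h (pickle q) t.
  apply: ge_inf; first by exists (g (c t)) => _ [n _ <-].
  by exists (pickle q).
apply: (le_trans le_h); rewrite /h /base pickleK.
have E : \sum_(i < k) `|c t ord0 i - map_mx ratr q ord0 i| <= e / 2.
  by apply: le_trans qe; apply: ler_sum => i _; rewrite mxE.
have : g (map_mx ratr q) - g (c t) <= e / 2.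
  rewrite (le_trans (ler_norm _))// (le_trans (gL _ _))// distrC.
  rewrite (le_trans (row_norm_le_sum _))//; apply: le_trans E.
  by apply: ler_sum => i _; rewrite !mxE.
lra.
Qed.

Lemma meas_BL1_proj n k (g : 'rV[R]_k -> R) : BL1 k g -> meas n (fun s => g (proj_k k s)).
Proof.
move=> gB; apply: measurable_BL1 => // i.
under eq_fun do rewrite mxE; exact: measurable_nth_sq.
Qed.

End lipschitz_test_functions.

(** * Stability of quotients *)

Section ratios.
Variable R : realType.

(** The cross difference is at most 2 d y and the denominator x is at least y / 2, whence the
    constant 4. *)
Lemma dist_ratio_le (a b x y d : R) : 0 < y -> d <= y / 2 -> `|a - b| <= d ->
  `|x - y| <= d -> `|b| <= y -> `|a / x - b / y| <= 4 * d / y.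
Proof.
move=> y0 dy ab xy by_.
have d0 : 0 <= d by rewrite (le_trans _ ab).
have hx : y / 2 <= x by move: xy; rewrite ler_norml; lra.
have x0 : 0 < x by lra.
have -> : a / x - b / y = ((a - b) * y - b * (x - y)) / (x * y).
  by field; rewrite !gt_eqF.
rewrite normrM normfV (ger0_norm (mulr_ge0 (ltW x0) (ltW y0))).
rewrite ler_pdivrMr ?mulr_gt0//.
rewrite (_ : 4 * d / y * (x * y) = 4 * d * x); last by field; rewrite gt_eqF.
have h1 : `|(a - b) * y - b * (x - y)| <= d * y + y * d.
  rewrite (le_trans (ler_normB _ _))// lerD// normrM.
    by rewrite (gtr0_norm y0) ler_wpM2r// ltW.
  by apply: ler_pM.
apply: (le_trans h1); have := ler_wpM2l d0 hx; lra.
Qed.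
End ratios.

(** * The bounded Lipschitz distance *)

Section bounded_lipschitz_distance.
Variables (R : realType) (k : nat).
Implicit Types (m : law R k).

Let BL1_0 : BL1 k (fun=> 0 : R).
Proof. by apply: BL1_const; rewrite normr0. Qed.

Lemma d_BL_le m1 m2 e : (forall g, BL1 k g -> `|m1 g - m2 g| <= e) -> d_BL k m1 m2 <= e.
Proof.
move=> h; apply: ge_sup; first by exists `|m1 (fun=> 0) - m2 (fun=> 0)|, (fun=> 0).
by move=> _ [g gB <-]; exact: h.
Qed.

Lemma d_BL_ge0 m1 m2 e : (forall g, BL1 k g -> `|m1 g - m2 g| <= e) -> 0 <= d_BL k m1 m2.
Proof.
move=> h; apply: (@le_trans _ _ `|m1 (fun=> 0) - m2 (fun=> 0)|) => //.
apply: ub_le_sup; last by exists (fun=> 0).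
by exists e => _ [g gB <-]; exact: h.
Qed.

(** A [law] is an arbitrary functional, so its differences need not be bounded on test functions;
    the bound c guarantees that both suprema are genuine, after which the triangle inequality
    applies. *)
Lemma d_BL_dist m1 m2 m1' m2' c e : (forall g, BL1 k g -> `|m1' g - m2' g| <= c) ->
  (forall g, BL1 k g -> `|m1 g - m1' g| <= e) ->
  (forall g, BL1 k g -> `|m2 g - m2' g| <= e) ->
  `|d_BL k m1 m2 - d_BL k m1' m2'| <= 2 * e.
Proof.
move=> hc h1 h2.
have ub (p q : law R k) C : (forall g, BL1 k g -> `|p g - q g| <= C) ->
    forall g, BL1 k g -> `|p g - q g| <= d_BL k p q.
  move=> hC g gB; apply: ub_le_sup; last by exists g.
  by exists C => _ [f fB <-]; exact: hC.
have tri g : BL1 k g -> `|m1 g - m2 g| <= `|m1' g - m2' g| + 2 * e.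
  move=> gB; have := h1 g gB; have := h2 g gB.
  by rewrite !ler_norml; have := ler_norm (m1' g - m2' g);
    have := ler_norm (- (m1' g - m2' g)); rewrite normrN; lra.
have tri' g : BL1 k g -> `|m1' g - m2' g| <= `|m1 g - m2 g| + 2 * e.
  move=> gB; have := h1 g gB; have := h2 g gB.
  by rewrite !ler_norml; have := ler_norm (m1 g - m2 g);
    have := ler_norm (- (m1 g - m2 g)); rewrite normrN; lra.
have hc2 g : BL1 k g -> `|m1 g - m2 g| <= c + 2 * e.
  by move=> gB; rewrite (le_trans (tri g gB))// lerD2r hc.
rewrite ler_norml; apply/andP; split.
  rewrite lerBrDl lerBlDr; apply: d_BL_le => g gB.
  by rewrite (le_trans (tri' g gB))// lerD2r (ub _ _ _ hc2).
rewrite lerBlDl; apply: d_BL_le => g gB.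
by rewrite (le_trans (tri g gB))// lerD2r (ub _ _ _ hc).
Qed.
End bounded_lipschitz_distance.

(** * Marginals of the uniform law on a ball *)

Section marginals_on_balls.
Variable R : realType.
Notation leb := (@lebesgue_measure R).
Variable V : R -> R.
Hypothesis oV : orlicz V.
Hypothesis iV : lint (fun x => expR (- V x)).
Let mV := orlicz_measurable oV.
Let V0 := orlicz_ge0 oV.

Lemma svol_gt0 n t : 0 < t -> 0 < svol V n t.
Proof.
elim: n t => [|n ih] t t0; first by rewrite svol0 (ltW t0).
have t20 : 0 < t / 2 by rewrite divr_gt0.
have [a /andP[a0 _] Va] := orlicz_small oV t20.
have [-> i1] := svol_succ mV iV n t.
apply: (LI_gt0 a0 (ih _ t20) i1) => x; first exact: svol_ge0.
by move=> /Va Vx; apply: le_svol => //; lra.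
Qed.

Lemma orlicz_ball_sublevel n r s : size s = n ->
  \1_(orlicz_ball V n r) s = \1_(sublevel V (r * n%:R)) s :> R.
Proof. by move=> sn; apply: indic_iff; split => [[]|]. Qed.

Lemma integr_ball n t (h : seq R -> R) : meas n h -> (forall s, `|h s| <= 1) ->
  integr n (fun s => \1_(sublevel V t) s * h s).
Proof.
move=> mh h1; apply: (@bounded_integr _ _ mV iV _ _ 1 t).
  by apply: measurable_funM => //; exact: meas_sublevel.
by move=> s; rewrite mul1r normrM ger0_norm ?sublevel_ge0// ler_piMr ?sublevel_ge0.
Qed.

Lemma iint_ball n r (h : seq R -> R) : meas n h -> (forall s, `|h s| <= 1) ->
  iint n (fun s => (\1_(orlicz_ball V n r) s * h s)%:E) =
  (En n (fun s => \1_(sublevel V (r * n%:R)) s * h s))%:E.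
Proof.
move=> mh h1.
rewrite (@iint_ext _ _ _ (EFin \o (fun s => \1_(sublevel V (r * n%:R)) s * h s))); last first.
  by move=> s sn; rewrite /= orlicz_ball_sublevel.
apply: (@iint_En _ _ mV iV _ _ 1 (r * n%:R)).
  by apply: measurable_funM => //; exact: meas_sublevel.
by move=> s; rewrite mul1r normrM ger0_norm ?sublevel_ge0// ler_piMr ?sublevel_ge0.
Qed.

Lemma vol_ball n r : vol n (orlicz_ball V n r) = (svol V n (r * n%:R))%:E.
Proof.
rewrite /vol (@iint_ext _ n _ (fun s => (\1_(orlicz_ball V n r) s * (fun=> 1) s)%:E)).
  have m1 : meas n (fun=> 1 : R) by exact: measurable_cst.
  have b1 (s : seq R) : `|(fun=> 1 : R) s| <= 1 by rewrite normr1.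
  rewrite (iint_ball r m1 b1).
  by congr EFin; apply: En_eq => s _; rewrite mulr1.
by move=> s _; rewrite mulr1.
Qed.

Lemma unif_E_ball n r (h : seq R -> R) : meas n h -> (forall s, `|h s| <= 1) ->
  unif_E n (orlicz_ball V n r) h =
  En n (fun s => \1_(sublevel V (r * n%:R)) s * h s) / svol V n (r * n%:R).
Proof. by move=> mh h1; rewrite /unif_E iint_ball// vol_ball. Qed.

Lemma proj_k_cat k (s s' : seq R) : size s = k -> proj_k k (s ++ s') = proj_k k s.
Proof. by move=> sk; apply/rowP => i; rewrite !mxE nth_cat sk ltn_ord. Qed.

(** Integrating out the last m coordinates leaves the slice volume as unnormalised density of the
    first k. The computation passes through [iint], where splitting off a block of coordinates is
    [iint_cat]. *)
Lemma En_marginal k m t g : BL1 k g ->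
  En (k + m) (fun s => \1_(sublevel V t) s * g (proj_k k s)) =
  En k (fun s => g (proj_k k s) * svol V m (t - \sum_(x <- s) V x)).
Proof.
move=> gB; have [g1 _] := gB.
have mg n : meas n (fun s => g (proj_k k s)) by exact: meas_BL1_proj.
apply: EFin_inj.
rewrite -(@iint_En _ _ mV iV _ _ 1 t); first 1 last.
- by apply: measurable_funM; [exact: (@meas_sublevel _ _ mV (k + m)%N t)|exact: mg].
- by move=> s; rewrite mul1r normrM ger0_norm ?sublevel_ge0// ler_piMr ?sublevel_ge0.
rewrite -(@iint_En _ _ mV iV _ _ (svol V m t) t); first 1 last.
- apply: measurable_funM; first exact: mg.
  apply: (measurableT_comp (measurable_svol mV iV m)).
  by apply: measurable_funB => //; exact: measurable_sumV.
- move=> s; rewrite normrM (ger0_norm (svol_ge0 _ _ _)) sublevelE.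
  case: (leP (\sum_(x <- s) V x) t) => /= St; last by rewrite (svol_neg V0) ?subr_lt0// !mulr0.
  rewrite mulr1 -[leRHS]mul1r ler_pM ?svol_ge0//.
  by apply: le_svol => //; rewrite gerBl sumr_ge0.
rewrite iint_cat; apply: iint_ext => s sk /=.
rewrite (@iint_ext _ _ _ (EFin \o (fun s' =>
    g (proj_k k s) * \1_(sublevel V (t - \sum_(x <- s) V x)) s'))); last first.
  move=> s' _ /=; rewrite proj_k_cat// mulrC !sublevelE big_cat/= lerBrDl.
  by [].
rewrite (@iint_En _ _ mV iV _ _ 1 (t - \sum_(x <- s) V x)); first 1 last.
- by apply: measurable_funM => //; exact: meas_sublevel.
- move=> s'; rewrite normrM (ger0_norm (sublevel_ge0 _ _ _)).
  by rewrite ler_wpM2r ?sublevel_ge0.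
by rewrite EnZ//; exact: integr_sublevel.
Qed.
End marginals_on_balls.

(** * Convergence of the marginals to the Gibbs product law *)

Section gibbs_limit.
Variable R : realType.
Notation leb := (@lebesgue_measure R).
Variable V : R -> R.
Hypothesis oV : orlicz V.
Hypothesis iV : forall b, 0 < b -> lint (fun x => expR (- b * V x)).
Let mV := orlicz_measurable oV.
Let V0 := orlicz_ge0 oV.
Let iV1 := lint_exp1 iV.
Notation Z := (Zf V).
Notation D := (Dv V).

Let w b s := expR (- b * \sum_(x <- s) V x).

(** Law of k independent coordinates with density e^(-bV) / Z(b). *)
Definition gibbs b k : law R k := fun g => En k (fun s => g (proj_k k s) * w b s) / Z b ^+ k.
Arguments gibbs : clear implicits.

Let iw k b : 0 < b -> integr k (w b) /\ En k (w b) = Z b ^+ k.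
Proof.
move=> b0; have [i1 E1] := En_exp k (measurable_funM (measurable_cst (- b)) mV) (iV b0).
rewrite /w; under [X in integr k X]eq_fun do rewrite mulr_sumr.
by under [X in En k X]eq_fun do rewrite mulr_sumr.
Qed.

Let sumV0 s : 0 <= \sum_(x <- s) V x.
Proof. exact: sumr_ge0. Qed.

Let w_anti b b' s : b <= b' -> w b' s <= w b s.
Proof. by move=> bb; rewrite ler_expR ler_wpM2r// lerN2. Qed.

Let integr_BL1M k g (q : seq R -> R) : BL1 k g -> integr k q ->
  integr k (fun s => g (proj_k k s) * q s).
Proof.
move=> gB qi; have [g1 _] := gB; apply: le_integr (integr_norm qi).
  by apply: measurable_funM; [exact: meas_BL1_proj|exact: integr_meas].
by move=> s _; rewrite normrM ler_piMl.
Qed.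

(** Two densities squeezed between the same L and U differ by at most d in L^1, which controls
    numerators and denominators at once and uniformly in g, as |g| <= 1. *)
Lemma weighted_ratio k (p q L U : seq R -> R) d g : BL1 k g ->
  integr k p -> integr k q -> integr k L -> integr k U ->
  (forall s, 0 <= p s) ->
  (forall s, size s = k -> L s <= p s <= U s) ->
  (forall s, size s = k -> L s <= q s <= U s) ->
  0 < En k p -> En k U - En k L <= d -> d <= En k p / 2 ->
  `|En k (fun s => g (proj_k k s) * q s) / En k q -
    En k (fun s => g (proj_k k s) * p s) / En k p| <= 4 * d / En k p.
Proof.
move=> gB ip iq iL iU p0 hp hq Ep ULd dp.
have [g1 _] := gB.
have diff s : size s = k -> `|q s - p s| <= U s - L s.
  by move=> sk; have := hp s sk; have := hq s sk; rewrite ler_norml; lra.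
have dist (h : seq R -> R) : integr k h ->
    (forall s, size s = k -> `|h s| <= U s - L s) -> `|En k h| <= d.
  move=> ih hh; rewrite (le_trans (En_norm ih))// (le_trans _ ULd)// -EnB//.
  by apply: En_le => //; [exact: integr_norm|exact: integrB].
have igp := integr_BL1M gB ip; have igq := integr_BL1M gB iq.
apply: dist_ratio_le => //.
- rewrite -EnB//; apply: dist; first exact: integrB.
  by move=> s sk; rewrite -mulrBr normrM (le_trans _ (diff s sk))// ler_piMl.
- by rewrite -EnB//; apply: dist => //; exact: integrB.
- rewrite (le_trans (En_norm igp))//; apply: En_le => //; first exact: integr_norm.
  by move=> s _; rewrite normrM (ger0_norm (p0 s)) ler_piMl.
Qed.

Lemma gibbs_bounded b k g : 0 < b -> BL1 k g -> `|gibbs b k g| <= 1.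
Proof.
move=> b0 gB; have [g1 _] := gB; have [i1 E1] := iw k b0.
have Zp : 0 < Z b ^+ k by rewrite exprn_gt0// Zf_gt0.
rewrite /gibbs normrM normfV (gtr0_norm Zp) ler_pdivrMr// mul1r -E1.
have ig := integr_BL1M gB i1.
rewrite (le_trans (En_norm ig))//; apply: En_le => //; first exact: integr_norm.
by move=> s _; rewrite normrM (ger0_norm (expR_ge0 _)) ler_piMl// expR_ge0.
Qed.

Lemma Zf_pow_continuous b0 k e : 0 < b0 -> 0 < e -> exists2 d, 0 < d & d < b0 /\
  forall b, `|b - b0| <= d -> `|Z b ^+ k - Z b0 ^+ k| <= e.
Proof.
move=> b00 e0; have b20 : 0 < b0 / 2 by rewrite divr_gt0.
(* Writing Z as a difference of values of D lets it inherit the Lipschitz bound. *)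
have ZD b : 0 < b -> Z b = D b 0 - D b 1.
  by move=> bp; have := Dv_shift oV iV 0 1 bp; rewrite add0r => ->; ring.
have [K0 K0p lip0] := Dv_lipschitz oV iV b20 (lexx 0).
have [K1 K1p lip1] := Dv_lipschitz oV iV b20 ler01.
have pc : {for Z b0, continuous (fun z : R => z ^+ k)} by exact: exprn_continuous.
have /cvgrPdist_le/(_ _ e0)/nbhs_ballP[c /= c0 Hc] := pc.
pose d := Num.min (b0 / 2) (c / (2 * (K0 + K1))).
have KK : 0 < 2 * (K0 + K1) by rewrite mulr_gt0// addr_gt0.
have d0 : 0 < d by rewrite lt_min b20 divr_gt0.
have db : d <= b0 / 2 by rewrite ge_min lexx.
have dc : d * (2 * (K0 + K1)) <= c by rewrite -ler_pdivlMr// ge_min lexx orbT.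
exists d => //; split => [|b bd]; first by lra.
have hb : b0 / 2 <= b by move: bd; rewrite ler_norml; lra.
have hb0 : b0 / 2 <= b0 by lra.
rewrite distrC; apply: Hc; rewrite /ball/= distrC !ZD//; last lra.
have := lip0 _ _ hb hb0; have := lip1 _ _ hb hb0.
have h0 := ler_wpM2l (ltW K0p) bd; have h1 := ler_wpM2l (ltW K1p) bd.
move: (D b 0) (D b0 0) (D b 1) (D b0 1) => x0 y0 x1 y1 l1 l0.
rewrite (_ : x0 - x1 - (y0 - y1) = x0 - y0 - (x1 - y1)); last by ring.
apply: (le_lt_trans (ler_normB _ _)).
apply: (le_lt_trans (lerD (le_trans l0 h0) (le_trans l1 h1))).
rewrite -mulrDl mulrC (lt_le_trans _ dc)// ltr_pM2l//.
by rewrite ltr_pMl ?addr_gt0// ltr1n.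
Qed.

(** Stated from the left only: raising the level lowers the parameter. The two Gibbs weights
    themselves then serve as L and U in [weighted_ratio]. *)
Lemma gibbs_continuous b0 k e : 0 < b0 -> 0 < e -> exists2 d, 0 < d &
  forall b, b0 - d <= b -> b <= b0 -> forall g, BL1 k g ->
    `|gibbs b k g - gibbs b0 k g| <= e.
Proof.
move=> b00 e0; have Zp : 0 < Z b0 ^+ k by rewrite exprn_gt0// Zf_gt0.
pose c := Num.min (Z b0 ^+ k / 2) (e * Z b0 ^+ k / 4).
have c0 : 0 < c by rewrite lt_min !divr_gt0// mulr_gt0.
have [d d0 [db Hd]] := Zf_pow_continuous k b00 c0.
exists d => // b bl bu g gB; have bp : 0 < b by lra.
have [i0 E0] := iw k b00; have [i1 E1] := iw k bp.
have := @weighted_ratio k (w b0) (w b) (w b0) (w b) c g gB i0 i1 i0 i1.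
rewrite E0 E1 -/(gibbs _ _ _) -/(gibbs _ _ _) => H.
apply: le_trans (H _ _ _ _ _ _) _ => //.
- by move=> s; exact: expR_ge0.
- by move=> s _; rewrite lexx w_anti.
- by move=> s _; rewrite lexx w_anti.
- by rewrite (le_trans (ler_norm _))// Hd// ler_distl bl (le_trans bu)// lerDl ltW.
- by rewrite ge_min lexx.
- by rewrite ler_pdivrMr// -ler_pdivlMl// mulrC ge_min lexx orbT.
Qed.

Section at_level.
Variables (r beta : R).
Hypotheses (r0 : 0 < r) (beta0 : 0 < beta) (Dr : D beta r = 0).

(** The slope bounds with b1 < beta < b2 place the marginal density between the weights for b2 and
    b1. The lower one holds only within bounded distance of the level, hence the cut-off sum V <= K
    in L. The budget c is shared equally by Z(b1), Z(b2) and the mass beyond K. *)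
Lemma lam_unif_gibbs k e : 0 < e -> \forall n \near \oo, forall g, BL1 k g ->
  `|lam_unif V n k r g - gibbs beta k g| <= e.
Proof.
move=> e0; have Zp : 0 < Z beta ^+ k by rewrite exprn_gt0// Zf_gt0.
pose c := Num.min (Z beta ^+ k / 2) (e * Z beta ^+ k / 4).
have c0 : 0 < c by rewrite lt_min !divr_gt0// mulr_gt0.
have c3 : 0 < c / 3 by rewrite divr_gt0.
have [d d0 [db Hd]] := Zf_pow_continuous k beta0 c3.
pose b1 := beta - d; pose b2 := beta + d.
have b10 : 0 < b1 by rewrite /b1; lra.
have b20 : 0 < b2 by rewrite /b2; lra.
have b1b : b1 < beta by rewrite /b1; lra.
have bb2 : beta < b2 by rewrite /b2; lra.
have Z1 : Z b1 ^+ k <= Z beta ^+ k + c / 3.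
  have := Hd b1; rewrite /b1 addrAC subrr add0r normrN gtr0_norm// lexx => /(_ isT).
  by rewrite ler_distl => /andP[].
have Z2 : Z beta ^+ k - c / 3 <= Z b2 ^+ k.
  have := Hd b2; rewrite /b2 addrAC subrr add0r gtr0_norm// lexx => /(_ isT).
  by rewrite ler_distl => /andP[].
clearbody b1 b2.
have h0 : 0 < b2 / 2 by rewrite divr_gt0.
pose A := Z (b2 / 2) ^+ k; have A0 : 0 < A by rewrite exprn_gt0// Zf_gt0.
(* Beyond K half of the exponent gives e^(-b2 K / 2) and the other half integrates to A; with y = b2
   K / 2 = A / (c / 3), the bound y <= e^y yields A e^(-y) <= c / 3. *)
pose K := A / (c / 3) / (b2 / 2); have K0 : 0 < K by rewrite !divr_gt0.
have Ksmall : A * expR (- (b2 / 2 * K)) <= c / 3.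
  rewrite expRN ler_pdivrMr ?expR_gt0// -ler_pdivrMl// mulrC.
  by rewrite (le_trans _ (le_expR _))// /K mulrCA divff ?mulr1// gt_eqF.
suff [N _ HN] : \forall n \near \oo, forall g, BL1 k g ->
    `|lam_unif V (k + n) k r g - gibbs beta k g| <= e.
  exists (k + N)%N => // n /= Nn g gB.
  have kn : (k <= n)%N by rewrite (leq_trans _ Nn)// leq_addr.
  rewrite -(subnKC kn); apply: HN => //=; by rewrite leq_subRL.
near=> n => g gB.
have sl : forall s t : R, s <= t -> t <= r * n%:R + r * k%:R ->
    svol V n s <= svol V n t * expR (- (b1 * (t - s))).
  by near: n; exact: (svol_slope_left oV iV r0 Dr).
have sr : forall s t : R, r * n%:R - K <= s -> s <= t ->
    svol V n t <= svol V n s * expR (b2 * (t - s)).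
  by near: n; exact: (svol_slope_right oV iV r0 beta0 Dr).
have n0 : (0 < n)%N by near: n; exact: nbhs_infty_gt.
set T := r * (k + n)%:R.
have TE : T = r * n%:R + r * k%:R by rewrite /T natrD mulrDr addrC.
have rk0 : 0 <= r * k%:R by rewrite mulr_ge0// ltW.
have T0 : 0 < T by rewrite TE ltr_wpDr// mulr_gt0// ltr0n.
have ST := svol_gt0 oV iV1 n T0.
pose q s := svol V n (T - \sum_(x <- s) V x) / svol V n T.
have mq : meas k q.
  apply: measurable_funM => //; apply: (measurableT_comp (measurable_svol mV iV1 n)).
  by apply: measurable_funB => //; exact: measurable_sumV.
have [iU EU] := iw k b10; have [iL0 EL0] := iw k b20; have [ip Ep] := iw k beta0.
have qU s : q s <= w b1 s.
  rewrite /q ler_pdivrMr// mulrC.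
  have := sl (T - \sum_(x <- s) V x) T; rewrite gerBl sumV0 TE lexx => /(_ isT isT).
  by rewrite opprB addrCA subrr addr0 -mulNr.
have q0 s : 0 <= q s by rewrite divr_ge0 ?svol_ge0// ltW.
have iq : integr k q by apply: le_integr iU => // s _; rewrite ger0_norm.
pose L s := w b2 s * \1_(sublevel V K) s.
have iL : integr k L.
  apply: (le_integr _ _ iL0).
    by apply: measurable_funM; [exact: integr_meas iL0|exact: meas_sublevel].
  move=> s _; rewrite normrM !ger0_norm ?expR_ge0 ?sublevel_ge0//.
  by rewrite ler_piMr ?expR_ge0// sublevelE; case: (_ <= _).
have Lw s : L s <= w b2 s.
  by rewrite /L ler_piMr ?expR_ge0// sublevelE; case: (_ <= _).
have Lq s : L s <= q s.
  rewrite /L sublevelE; case: (leP (\sum_(x <- s) V x) K) => /= SK; last by rewrite mulr0.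
  rewrite mulr1 /q ler_pdivlMr// mulrC.
  have TS : r * n%:R - K <= T - \sum_(x <- s) V x.
    by rewrite TE -addrA lerD2l -[- K]add0r lerD// lerN2.
  have := sr _ T TS; rewrite gerBl sumV0 opprB addrCA subrr addr0 => /(_ isT).
  move=> /(ler_wpM2r (expR_ge0 (- b2 * \sum_(x <- s) V x))).
  have E1 : expR (b2 * \sum_(x <- s) V x) * expR (- b2 * \sum_(x <- s) V x) = 1.
    by rewrite -expRD mulNr subrr expR0.
  by rewrite -[leRHS]mulrA E1 mulr1.
have EL : Z b2 ^+ k - c / 3 <= En k L.
  have [iA EA] := iw k h0.
  have i3 := integrZ (expR (- (b2 / 2 * K))) iA.
  rewrite lerBlDr -EL0; apply: le_trans (lerD (lexx _) Ksmall).
  rewrite /A -EA mulrC -EnZ// -EnD//.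
  rewrite mulrC in i3 *.
  apply: En_le => //; [by apply: integrD|].
  move=> s _; rewrite /L sublevelE; case: (leP (\sum_(x <- s) V x) K) => /= SK.
    by rewrite mulr1 lerDl mulr_ge0 ?expR_ge0.
  rewrite mulr0 add0r /w -expRD ler_expR.
  have -> : - b2 * \sum_(x <- s) V x =
      - (b2 / 2 * \sum_(x <- s) V x) + - (b2 / 2) * \sum_(x <- s) V x by field.
  by rewrite lerD2r lerN2 [leLHS]mulrC; exact: (ler_wpM2l (ltW h0) (ltW SK)).
have -> : lam_unif V (k + n) k r g =
    En k (fun s => g (proj_k k s) * q s) / En k q.
  have [g1 _] := gB.
  rewrite /lam_unif (unif_E_ball oV iV1) //; last exact: meas_BL1_proj.
  rewrite (En_marginal oV iV1)// -/T.
  have B1 : BL1 k (fun=> 1 : R) by apply: BL1_const; rewrite normr1.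
  have := En_marginal oV iV1 n T B1.
  under eq_fun do rewrite mulr1; rewrite -/(svol V _ _) => ->.
  under [X in En k X / _]eq_fun do rewrite -[svol _ _ _](divfK (lt0r_neq0 ST)) -/(q _) mulrA mulrC.
  under [X in _ / En k X]eq_fun do rewrite mul1r -[svol _ _ _](divfK (lt0r_neq0 ST)) -/(q _) mulrC.
  rewrite EnZ; last exact: integr_BL1M.
  by rewrite EnZ// -mulf_div divff ?mul1r// gt_eqF.
rewrite /gibbs -[in X in _ - X]Ep.
apply: le_trans (@weighted_ratio k (w beta) q L (w b1) c g gB ip iq iL iU _ _ _ _ _ _) _.
- by move=> s; exact: expR_ge0.
- by move=> s _; rewrite w_anti ?(ltW b1b)// (le_trans (Lw s))// w_anti// ltW.
- by move=> s _; rewrite Lq qU.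
- by rewrite Ep.
- by rewrite EU lerBlDr (le_trans Z1)// -lerBlDl (le_trans _ EL)// lerBrDr;
    apply: le_trans Z2; rewrite le_eqVlt; apply/orP; left; apply/eqP; field.
- by rewrite Ep ge_min lexx.
- by rewrite Ep ler_pdivrMr// -ler_pdivlMl// mulrC ge_min lexx orbT.
Unshelve. all: by end_near. Qed.

End at_level.
End gibbs_limit.
Arguments gibbs {R} V b k _.

(** * The conditioned law against the uniform law *)

Section conditioned_law.
Variable R : realType.
Notation leb := (@lebesgue_measure R).
Variables V W : R -> R.
Hypotheses (oV : orlicz V) (oW : orlicz W).
Hypotheses (iV : lint (fun x => expR (- V x))) (iW : lint (fun x => expR (- W x))).
Let mV := orlicz_measurable oV.
Let mW := orlicz_measurable oW.

Let meas_ball_mul n r (h : seq R -> R) : meas n h ->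
  meas n (fun s => \1_(orlicz_ball V n r) s * h s).
Proof.
move=> mh; have m1 : meas n (fun s => \1_(sublevel V (r * n%:R)) s * h s).
  by apply: measurable_funM; [exact: meas_sublevel|exact: mh].
by apply: eq_measurable_fun m1 => p _; rewrite orlicz_ball_sublevel// size_sq.
Qed.

(** The volume of the [W]-ball cancels, so conditioning gives the uniform law on the intersection of
    the balls. The intersection misses at most a fraction e of the [V]-ball, and [dist_ratio_le]
    concludes. *)
Lemma lam_cond_unif n k r eps e g : (0 < n)%N -> BL1 k g -> e <= 2^-1 ->
  0 < svol V n ((r + eps) * n%:R) ->
  En n (fun s => \1_(sublevel V ((r + eps) * n%:R)) s * (1 - \1_(sublevel W n%:R) s)) <=
    e * svol V n ((r + eps) * n%:R) ->
  `|lam_cond W V n k r eps g - lam_unif V n k (r + eps) g| <= 4 * e.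
Proof.
move=> n0 gB e2; set t := (r + eps) * n%:R => St excess; have [g1 _] := gB.
have ind1 A (s : seq R) : `|\1_A s| <= 1 :> R.
  by rewrite indicE; case: (_ \in _); rewrite ?normr1 ?normr0.
have mg : meas n (fun s => g (proj_k k s)) by exact: meas_BL1_proj.
have m1 : meas n (fun=> 1 : R) by exact: measurable_cst.
have c0 : 0 < svol W n (1 * n%:R) by rewrite mul1r svol_gt0// ltr0n.
pose F h := En n (fun s => \1_(sublevel V t) s * (\1_(sublevel W n%:R) s * h s)).
have unifE h : meas n h -> (forall s, `|h s| <= 1) ->
    unif_E n (orlicz_ball W n 1) (fun s => \1_(orlicz_ball V n (r + eps)) s * h s) =
    F h / svol W n (1 * n%:R).
  move=> mh h1; rewrite (unif_E_ball oW iW); first 1 last.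
  - exact: meas_ball_mul.
  - by move=> s; rewrite normrM mulr_ile1.
  congr (_ / _); apply: En_eq => s sn; rewrite mul1r orlicz_ball_sublevel//.
  by rewrite mulrCA.
have -> : lam_cond W V n k r eps g = F (fun s => g (proj_k k s)) / F (fun=> 1).
  rewrite /lam_cond unifE//; have := unifE (fun=> 1) m1 (fun _ => _).
  under [X in unif_E _ _ X]eq_fun do rewrite mulr1.
  move=> ->; last by rewrite normr1.
  by rewrite invf_div mulrA divfK// gt_eqF.
rewrite /lam_unif (unif_E_ball oV iV)// -/t.
have iF h : meas n h -> (forall s, `|h s| <= 1) ->
    integr n (fun s => \1_(sublevel V t) s * (\1_(sublevel W n%:R) s * h s)).
  move=> mh h1; apply: (integr_ball oV iV).
    by apply: measurable_funM; [exact: meas_sublevel|exact: mh].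
  by move=> s; rewrite normrM mulr_ile1.
have iG h : meas n h -> (forall s, `|h s| <= 1) -> integr n (fun s => \1_(sublevel V t) s * h s).
  exact: integr_ball.
have excess_ge h : meas n h -> (forall s, `|h s| <= 1) ->
    `|F h - En n (fun s => \1_(sublevel V t) s * h s)| <= e * svol V n t.
  move=> mh h1; rewrite /F -EnB; [|exact: iF|exact: iG].
  have ib := integrB (iF h mh h1) (iG h mh h1).
  rewrite (le_trans (En_norm ib))// (le_trans _ excess)//.
  apply: En_le; first exact: integr_norm.
    have := integrB (iG _ m1 (fun s => _)) (iF _ m1 (fun s => _)).
    move=> /(_ _ _)/integr_eq; apply => // [s _|s|s]; rewrite ?normr1//.
    by rewrite -mulrBr mulr1.
  move=> s _; rewrite -mulrBr -[X in _ - X]mul1r -mulrBl !normrM.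
  rewrite ger0_norm ?sublevel_ge0// ler_wpM2l ?sublevel_ge0//.
  apply: le_trans (ler_piMr _ (h1 s)) _ => //.
  rewrite sublevelE; case: (_ <= n%:R) => /=; first by rewrite subrr normr0.
  by rewrite sub0r normrN subr0 normr1.
apply: le_trans (@dist_ratio_le R _ _ _ _ (e * svol V n t) St _ _ _ _) _.
- by rewrite mulrC ler_wpM2l// ltW.
- exact: excess_ge.
- have h11 (s : seq R) : `|(fun=> 1 : R) s| <= 1 by rewrite normr1.
  have E1 : En n (fun s => \1_(sublevel V t) s * (fun=> 1 : R) s) = svol V n t.
    by apply: En_eq => s _; rewrite mulr1.
  by have := excess_ge _ m1 h11; rewrite E1.
- have ig := iG _ mg (fun s => g1 _).
  rewrite (le_trans (En_norm ig))//; apply: En_le; first exact: integr_norm.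
    exact: integr_sublevel.
  by move=> s _; rewrite normrM (ger0_norm (sublevel_ge0 _ _ _)) ler_piMr// sublevel_ge0.
by rewrite mulrA mulfK// gt_eqF.
Qed.
End conditioned_law.

(** * Integrability drawn from the hypotheses on V1 and V2 *)

Section integrability.
Variable R : realType.
Notation leb := (@lebesgue_measure R).
Variables V W : R -> R.
Hypotheses (oV : orlicz V) (oW : orlicz W).
Let mV := orlicz_measurable oV.
Let mW := orlicz_measurable oW.

Lemma lint_exp_of_mul b : 0 < b -> lint (fun x => W x * expR (- b * V x)) ->
  lint (fun x => expR (- b * V x)).
Proof.
move=> b0 iW; have W1 := orlicz1_gt0 oW.
have [ii _] := @lint_indic_itv R 1 ler01.
have := lintD ii (lintZ (W 1)^-1 iW); apply: lint_le.
  by apply: measurableT_comp => //; exact: measurable_funM.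
move=> x; rewrite ger0_norm ?expR_ge0//.
have p0 : 0 <= (W 1)^-1 * (W x * expR (- b * V x)).
  by rewrite !mulr_ge0 ?invr_ge0 ?expR_ge0 ?(orlicz_ge0 oW).
have [x1|x1] := leP `|x| 1.
  rewrite indicE mem_set/=; last by rewrite /= in_itv/= -ler_norml.
  by rewrite ler_wpDr// -[leRHS]expR0 ler_expR mulNr oppr_le0 mulr_ge0 ?(ltW b0) ?(orlicz_ge0 oV).
rewrite ler_wpDl// mulrA ler_peMl ?expR_ge0// ler_pdivlMl// mulr1.
by apply: (orlicz_mono oW); rewrite normr1 ltW.
Qed.

Lemma lint_exp_dominating : W x / V x @[x --> +oo] --> +oo ->
  lint (fun x => expR (- V x)) -> lint (fun x => expR (- W x)).
Proof.
move=> /cvgryPge/(_ 1) [A [_ HA]] iV.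
pose a := Num.max A 0 + 1.
have a0 : 0 <= a by rewrite addr_ge0// le_max lexx orbT.
have [ii _] := lint_indic_itv a0.
have := lintD ii iV; apply: lint_le.
  by apply: measurableT_comp => //; exact: measurableT_comp.
move=> x; rewrite ger0_norm ?expR_ge0//.
have [xa|xa] := leP `|x| a.
  rewrite indicE mem_set/=; last by rewrite /= in_itv/= -ler_norml.
  by rewrite ler_wpDr ?expR_ge0// -[leRHS]expR0 ler_expR oppr_le0 (orlicz_ge0 oW).
rewrite ler_wpDl// ler_expR lerN2.
have Ax : A < `|x|.
  by rewrite (le_lt_trans _ xa)// /a ler_wpDr// le_max lexx.
have x0 : x != 0 by rewrite -normr_gt0 (le_lt_trans a0).
have V0 : 0 < V x by case: oV => _ _ _; apply.
have := HA _ Ax; rewrite (orlicz_abs oW) (orlicz_abs oV).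
by rewrite ler_pdivlMr// mul1r.
Qed.

Lemma mulV_integral_gt0 b : 0 < b -> (forall b, 0 < b -> lint (fun x => expR (- b * V x))) ->
  0 < \int[leb]_x (V x * expR (- b * V x)).
Proof.
move=> b0 iV; have V0 := orlicz_ge0 oV.
(* Lower bound of the integrand on 1 < |x| <= 2: the integrand vanishes at 0, so a neighbourhood of
   0 cannot serve. *)
pose c := V 1 * expR (- b * V 2).
have c0 : 0 < c by rewrite mulr_gt0 ?expR_gt0// (orlicz1_gt0 oV).
have [i1 E1] := @lint_indic_itv R 1 ler01.
have [i2 E2] := @lint_indic_itv R 2 (ler0n R 2).
apply: (@lt_le_trans _ _ (\int[leb]_x (c * (\1_`[- 2, 2]%classic x - \1_`[- 1, 1]%classic x)))).
  by rewrite LIZ ?LIB ?E1 ?E2//; [rewrite mulr_gt0//; lra|exact: lintB].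
apply: LI_le; [exact/lintZ/lintB|exact: lint_V|].
move=> x; have Vx0 : 0 <= V x * expR (- b * V x) by rewrite mulr_ge0 ?expR_ge0.
rewrite !indicE; case: (boolP (x \in `[-2, 2]%classic)) => h2; last first.
  by rewrite (le_trans _ Vx0)// mulr_ge0_le0 ?(ltW c0)// sub0r oppr_le0.
case: (boolP (x \in `[-1, 1]%classic)) => h1; first by rewrite subrr mulr0.
have {}h1 : 1 < `|x|.
  by rewrite ltNge; apply: contra h1 => x1; rewrite inE/= in_itv/= -ler_norml.
have {}h2 : `|x| <= 2 by move: h2; rewrite inE/= in_itv/= -ler_norml.
rewrite subr0 mulr1 /c.
apply: ler_pM; rewrite ?expR_ge0 ?V0//.
  by apply: (orlicz_mono oV); rewrite normr1 ltW.
rewrite ler_expR !mulNr lerN2 ler_wpM2l ?(ltW b0)//.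
by apply: (orlicz_mono oV); rewrite (ger0_norm (x := 2)).
Qed.
End integrability.

(** * Choice of the threshold and the two limits *)

Lemma error_split (R : realFieldType) (e : R) : 0 < e ->
  e / 6 <= e / 2 /\ 4 * (e / 24) + e / 6 <= e / 2.
Proof. by move=> e0; split; lra. Qed.

Theorem theoremB (R : realType) (V1 V2 : R -> R) :
  orlicz V1 -> orlicz V2 ->
  (V1 x / V2 x @[x --> +oo] --> +oo) ->
  (V1 x / V2 x @[x --> -oo] --> +oo) ->
  (forall alpha : R, alpha < 0 ->
     (@lebesgue_measure R).-integrable setT
       (fun x => (V1 x * expR (alpha * V2 x))%:E)) ->
  exists Rbar : R, 0 < Rbar /\
    forall Rad : R, 0 < Rad -> Rad <= Rbar ->
    forall k : nat,
      exists L : R -> R,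
        (\forall eps \near 0^'+,
           d_BL k (lam_cond V1 V2 n k Rad eps) (lam_unif V2 n k Rad) @[n --> \oo]
             --> L eps) /\
        (L eps @[eps --> 0^'+] --> 0).
Proof.
move=> o1 o2 lim_pinfty _ int12.
have i12 b : 0 < b -> lint (fun x => V1 x * expR (- b * V2 x)).
  by move=> b0; apply: int12; rewrite oppr_lt0.
have i2 b : 0 < b -> lint (fun x => expR (- b * V2 x)).
  by move=> b0; apply: (lint_exp_of_mul o2 o1) => //; exact: i12.
have i2' := lint_exp1 i2.
have i1' := lint_exp_dominating o2 o1 lim_pinfty i2'.
have e4 : 0 < 4^-1 :> R by rewrite invr_gt0.
(* For every b >= b0 the Gibbs mean of [V1] is at most 1/4, so the first constraint is inactive at
   all these parameters. *)
have [b0 b01 small] := concentration o2 i2 o1 i12 e4.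
have b0p : 0 < b0 by rewrite (lt_le_trans ltr01).
have Z0 := Zf_gt0 o2 i2 b0p.
set mean := \int[@lebesgue_measure R]_x (V2 x * expR (- b0 * V2 x)).
have mean0 : 0 < mean by exact: mulV_integral_gt0.
(* Gibbs mean of [V2] at b0; since the mean decreases in b, levels below [top] belong to parameters
   above b0. *)
pose top := mean / Zf V2 b0; have top0 : 0 < top by rewrite divr_gt0.
have D0 c : c < top -> 0 < Dv V2 b0 c.
  by move=> ct; rewrite (DvE o2 i2)// -/mean subr_gt0 -ltr_pdivlMr.
(* Inverse of the Gibbs mean; the default 1 is never reached for 0 < c < top. *)
pose bet c := xget 1 [set b | b0 < b /\ Dv V2 b c = 0].
have betP c : 0 < c -> c < top -> b0 < bet c /\ Dv V2 (bet c) c = 0.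
  move=> c0 ct; have [b b0b Db] := exists_beta o2 i2 b0p c0 (D0 c ct).
  by rewrite /bet; case: xgetP => [x -> []//|/(_ b)]; case.
(* Half of [top] leaves room for r + eps < top when eps is small. *)
exists (top / 2); split; first by rewrite divr_gt0.
move=> r r0 rtop k; have rt : r < top by lra.
have [bb bD] := betP r r0 rt.
have bp : 0 < bet r by rewrite (lt_trans b0p).
exists (fun eps => d_BL k (gibbs V2 (bet (r + eps)) k) (gibbs V2 (bet r) k)).
have eps_ok : \forall eps \near 0^'+, 0 < eps /\ r + eps < top.
  near=> eps; split; first by near: eps; exact: nbhs_right_gt.
  by rewrite -ltrBrDl; near: eps; apply: nbhs_right_lt; rewrite subr_gt0.
have gibbs_dist b g : 0 < b -> BL1 k g -> `|gibbs V2 b k g - gibbs V2 (bet r) k g| <= 2.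
  move=> b_gt0 gB; have := gibbs_bounded o2 i2 b_gt0 gB.
  have := gibbs_bounded o2 i2 bp gB => h1 h2.
  by rewrite (le_trans (ler_normB _ _))// -[2]/(1 + 1) lerD.
split.
  near=> eps.
  have [eps0 et] : 0 < eps /\ r + eps < top by near: eps.
  have re0 : 0 < r + eps by rewrite addr_gt0.
  have [cb cD] := betP _ re0 et; have cp := lt_trans b0p cb.
  apply/cvgrPdist_le => e e0.
  have e1 : 0 < Num.min (e / 24) (2^-1 : R) by rewrite lt_min divr_gt0//= invr_gt0.
  have e6 : 0 < e / 6 by rewrite divr_gt0.
  have mean1 : \int[@lebesgue_measure R]_x (V1 x * expR (- bet (r + eps) * V2 x)) <=
      Zf V2 (bet (r + eps)) / 4.
    by rewrite mulrC; apply: small; exact: ltW.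
  have near1 := lam_unif_gibbs o2 i2 re0 cp cD k e6.
  have near2 := lam_unif_gibbs o2 i2 r0 bp bD k e6.
  near=> n.
  have n0 : (0 < n)%N by near: n; exact: nbhs_infty_gt.
  have excess : En n (fun s => \1_(sublevel V2 ((r + eps) * n%:R)) s *
      (1 - \1_(sublevel V1 n%:R) s)) <=
      Num.min (e / 24) 2^-1 * svol V2 n ((r + eps) * n%:R).
    by near: n; exact: (constraint_inactive o2 o1 i2 i12 re0 cp cD mean1 e1).
  have [u1 u2] : (forall g, BL1 k g ->
      `|lam_unif V2 n k (r + eps) g - gibbs V2 (bet (r + eps)) k g| <= e / 6) /\
      forall g, BL1 k g -> `|lam_unif V2 n k r g - gibbs V2 (bet r) k g| <= e / 6.
    by near: n; exact: filterI near1 near2.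
  have [e62 e246] := error_split e0.
  rewrite distrC -[leRHS](divfK (x := 2))// mulrC.
  apply: (@d_BL_dist _ _ _ _ _ _ 2) => [g gB|g gB|g gB].
  - exact: gibbs_dist.
  - have Spos : 0 < svol V2 n ((r + eps) * n%:R).
      by apply: (svol_gt0 o2 i2'); rewrite mulr_gt0// ltr0n.
    have m2 : Num.min (e / 24) (2^-1 : R) <= 2^-1 by rewrite ge_min lexx orbT.
    have := lam_cond_unif o2 o1 i2' i1' n0 gB m2 Spos excess.
    have m24 : Num.min (e / 24) (2^-1 : R) <= e / 24 by rewrite ge_min lexx.
    move=> H; apply: (le_trans (ler_distD (lam_unif V2 n k (r + eps) g) _ _)).
    apply: (le_trans (lerD H (u1 g gB))); apply: le_trans e246.
    by rewrite lerD2r ler_wpM2l.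
  - by rewrite (le_trans (u2 g gB)).
apply/cvgrPdist_le => e e0.
have [d d0 Hd] := gibbs_continuous o2 i2 k bp e0.
(* Lower barrier for the parameter at r + eps; the maximum with b0 keeps it positive. As bd < bet r,
   the mean at bd exceeds r, hence also r + eps for small eps, and monotonicity places
   [bet (r + eps)] between bd and [bet r]. *)
pose bd := Num.max (bet r - d) b0.
have bdp : 0 < bd by rewrite lt_max b0p orbT.
have bdr : bd < bet r by rewrite gt_max bb andbT; lra.
have Zbd := Zf_gt0 o2 i2 bdp; have Zbet := Zf_gt0 o2 i2 bp.
have Dbd : 0 < Dv V2 bd r.
  rewrite ltNge; apply/negP => H.
  by have := Dv_strict o2 i2 bdp bdr r0 H; rewrite bD ltxx.
near=> eps.
have [eps0 et] : 0 < eps /\ r + eps < top by near: eps.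
have re0 : 0 < r + eps by rewrite addr_gt0.
have [cb cD] := betP _ re0 et; have cp := lt_trans b0p cb.
have Dsmall : 0 < Dv V2 bd (r + eps).
  have small_eps : eps < Dv V2 bd r / Zf V2 bd.
    by near: eps; apply: nbhs_right_lt; exact: divr_gt0.
  by rewrite (Dv_shift o2 i2 r eps bdp) subr_gt0 -ltr_pdivlMr.
have lo : bd <= bet (r + eps).
  rewrite leNgt; apply/negP => H.
  have cD' : Dv V2 (bet (r + eps)) (r + eps) <= 0 by rewrite cD.
  by have := Dv_strict o2 i2 cp H re0 cD'; rewrite ltNge (ltW Dsmall).
have hi : bet (r + eps) <= bet r.
  rewrite leNgt; apply/negP => H.
  have bD' : Dv V2 (bet r) (r + eps) <= 0.
    by rewrite (Dv_shift o2 i2 r eps bp) bD sub0r oppr_le0 mulr_ge0// ltW.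
  by have := Dv_strict o2 i2 bp H re0 bD'; rewrite cD ltxx.
have close g : BL1 k g ->
    `|gibbs V2 (bet (r + eps)) k g - gibbs V2 (bet r) k g| <= e.
  apply: Hd => //; rewrite (le_trans _ lo)// /bd le_max lexx//.
rewrite sub0r normrN ger0_norm; last exact: (d_BL_ge0 close).
exact: d_BL_le.
Unshelve. all: by end_near. Qed.
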